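(* Let $d\ge 2$ and let $\mathcal S=\mathrm{CPTP}_d$ be the family of all quantum channels on $\mathcal B(\mathbb C^d)$. Let $S,P_1,P_2,S'$ be registers, each with Hilbert space $\mathbb C^d$, and for $X\in\mathcal B(\mathcal H_S\otimes\mathcal H_{P_1}\otimes\mathcal H_{P_2})$ define $$\mathcal M(X):=\mathrm{Tr}_{SP_1}\!\left[(\Omega_{SP_1}\otimes I_{P_2})X\right],\qquad \mathcal P_*(X):=\left(\frac{\mathrm{Tr} X}{d}-\mathrm{Tr}[\mathcal M(X)]\right)I_{S'}+d\,\mathcal M(X),$$ where $\Omega_{SP_1}=\sum_{i,j=0}^{d-1}|ii\rangle\langle jj|$ and $\mathcal M(X)$ (an operator on $P_2\simeq S'$) is regarded as an operator on $S'$. Then: (i) $\mathcal P_*$ is the unique covariant exact retriever for $\mathcal S$; in particular $\mathcal P_*(\rho\otimes\pi_{\mathcal E})=\mathcal E(\rho)$ for every state $\rho$ and every $\mathcal E\in\mathcal S$. (ii) $\mathcal P_*$ attains the global minimum of $\|\mathcal P\|_\diamond$ over all exact (one-copy) retrievers $\mathcal P$ for $\mathcal S$, and this minimum is $$\nu_1(\mathrm{CPTP}_d)=\|\mathcal P_*\|_\diamond=2d^2-3+\frac{2}{d^2}.$$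
   Context: For a linear map $\mathcal E:\mathcal B(\mathcal H_A)\to\mathcal B(\mathcal H_B)$ with $d_A=\dim\mathcal H_A$ and a fixed computational basis, the Choi operator is $J_{\mathcal E}=\sum_{i,j}|i\rangle\langle j|\otimes\mathcal E(|i\rangle\langle j|)\in\mathcal B(\mathcal H_A\otimes\mathcal H_B)$; the normalized Choi state (program state) of a channel is $\pi_{\mathcal E}=J_{\mathcal E}/d_A$. CPTP means completely positive trace preserving (quantum channel); HPTP means linear, Hermiticity preserving and trace preserving. The diamond norm of a linear map $\mathcal P$ is $\|\mathcal P\|_\diamond=\sup_R\sup_{\|X\|_1\le1}\|(\mathrm{id}_R\otimes\mathcal P)(X)\|_1$ over finite-dimensional references $R$. The program register is $P=P_1\otimes P_2$, with $P_1$ carrying the input half and $P_2$ the output half of $\pi_{\mathcal E}$. An exact (one-copy) retriever for $\mathcal S\subseteq\mathrm{CPTP}_d$ is an HPTP map $\mathcal P:\mathcal B(\mathcal H_S\otimes\mathcal H_P)\to\mathcal B(\mathcal H_{S'})$, independent of the target, with $\mathcal P(\rho\otimes\pi_{\mathcal E})=\mathcal E(\rho)$ for all states $\rho$ and all $\mathcal E\in\mathcal S$. The exact one-copy programming overhead is $\nu_1(\mathcal S)=\min\|\mathcal P\|_\diamond$ over all exact retrievers for $\mathcal S$. A retriever $\mathcal P$ is called covariant here if its Choi operator $J_{\mathcal P}$ on $\mathcal H_S\otimes\mathcal H_{P_1}\otimes\mathcal H_{P_2}\otimes\mathcal H_{S'}$ commutes with $U\otimes U^*\otimes V\otimes V^*$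 for all $U,V\in \mathrm{SU}(d)$, where $U^*$ is the entrywise complex conjugate. *)

(* Defs.v *)
From HB Require Import structures.
From mathcomp Require Import all_boot all_order all_algebra.
From mathcomp Require Import sesquilinear spectral.
From mathcomp Require Import all_classical all_reals ereal.
From mathcomp Require Import complex mxtens ring.

Set Implicit Arguments.
Unset Strict Implicit.
Unset Printing Implicit Defensive.

Import Order.TTheory GRing.Theory Num.Theory.

Local Open Scope classical_set_scope.
Local Open Scope ring_scope.
Local Open Scope sesquilinear_scope.

(* B(C^n) is 'M[R[i]]_n, and B(C^m (x) C^n) is 'M[R[i]]_(m * n), where the basis
   vector |i>|j> has index mxtens_index (i, j). *)
Notation superop R m n := {linear 'M[R[i]]_m -> 'M[R[i]]_n}.

Section Operators.
Variable R : realType.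
Local Notation C := R[i].

Definition psdmx n (A : 'M[C]_n) : Prop :=
  A \is hermsymmx /\ forall v : 'cV[C]_n, 0 <= (v ^t* *m A *m v) 0 0.

Definition density n (rho : 'M[C]_n) : Prop := psdmx rho /\ \tr rho = 1.

(* Sum of the singular values; the eigenvalues of X^* X are real and
   nonnegative, so Re only changes the type. *)
Definition trnorm n (X : 'M[C]_n) : R :=
  \sum_i Num.sqrt (complex.Re (spectral_diag (X ^t* *m X) 0 i)).

Definition mxtens_block m n (X : 'M[C]_(m * n)) (i j : 'I_m) : 'M[C]_n :=
  \matrix_(k, l) X (mxtens_index (i, k)) (mxtens_index (j, l)).

(* The partial trace over the left tensor factor. *)
Definition ptracel m n (X : 'M[C]_(m * n)) : 'M[C]_n :=
  \sum_i mxtens_block X i i.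

(* id_r (x) f, applied blockwise. *)
Definition ampliation r m n (f : superop R m n) (X : 'M[C]_(r * m)) :
    'M[C]_(r * n) :=
  \sum_i \sum_j delta_mx i j *t f (mxtens_block X i j).

Definition dnorm m n (f : superop R m n) : \bar R :=
  ereal_sup [set y | exists (r : nat) (X : 'M[C]_(r * m)),
                       trnorm X <= 1 /\ y = (trnorm (ampliation f X))%:E].

Definition choi m n (f : superop R m n) : 'M[C]_(m * n) :=
  \sum_i \sum_j delta_mx i j *t f (delta_mx i j).

Definition choi_state m n (f : superop R m n) : 'M[C]_(m * n) :=
  m%:R^-1 *: choi f.

Definition trace_preserving m n (f : superop R m n) : Prop :=
  forall X, \tr (f X) = \tr X.

Definition completely_positive m n (f : superop R m n) : Prop :=
  forall r (X : 'M[C]_(r * m)), psdmx X -> psdmx (ampliation f X).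

Definition hermiticity_preserving m n (f : superop R m n) : Prop :=
  forall X, X \is hermsymmx -> f X \is hermsymmx.

Definition hptp m n (f : superop R m n) : Prop :=
  hermiticity_preserving f /\ trace_preserving f.

Definition cptp d : set (superop R d d) :=
  [set f | completely_positive f /\ trace_preserving f].

End Operators.

Arguments cptp R d : clear implicits.

Section Retrievers.
Variables (R : realType) (d : nat).
Local Notation C := R[i].

(* The register S (x) P has dimension d * (d * d), with P = P1 (x) P2. *)
Local Notation retriever := (superop R (d * (d * d)) d).

Definition exact_retriever (S : set (superop R d d)) (P : retriever) : Prop :=
  hptp P /\
  forall (rho : 'M[C]_d) (f : superop R d d),
    density rho -> S f -> P (rho *t choi_state f) = f rho.

Definition overhead1 (S : set (superop R d d)) : \bar R :=
  ereal_inf [set dnorm P | P in exact_retriever S].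

Definition special_unitary (U : 'M[C]_d) : Prop :=
  U \is unitarymx /\ \det U = 1.

Definition covariant (P : retriever) : Prop :=
  forall U V : 'M[C]_d, special_unitary U -> special_unitary V ->
    comm_mx (choi P)
      (U *t (map_mx Num.conj U *t V) *t map_mx Num.conj V).

(* |ii><jj| = |i><j| (x) |i><j| *)
Definition Omega : 'M[C]_(d * d) :=
  \sum_i \sum_j delta_mx i j *t delta_mx i j.

(* S (x) (P1 (x) P2) is identified with (S (x) P1) (x) P2; both index the basis
   vector |i>|j>|k> by (i * d + j) * d + k, so the identification is a cast. *)
Definition reassoc (X : 'M[C]_(d * (d * d))) : 'M[C]_(d * d * d) :=
  castmx (mulnA d d d, mulnA d d d) X.

Fact reassoc_tens (A B D : 'M[C]_d) : reassoc (A *t (B *t D)) = A *t B *t D.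
Proof.
apply/matrixP => i j; rewrite castmxE /=.
have unindexA (k : 'I_(d * d * d)) :
    let k' := cast_ord (esym (mulnA d d d)) k in
    [/\ (mxtens_unindex k').1 = (mxtens_unindex (mxtens_unindex k).1).1,
        (mxtens_unindex (mxtens_unindex k').2).1
          = (mxtens_unindex (mxtens_unindex k).1).2
      & (mxtens_unindex (mxtens_unindex k').2).2 = (mxtens_unindex k).2].
  case: (mxtens_indexP k) => ab c; case: (mxtens_indexP ab) => a b k'.
  have -> : k' = mxtens_index (a, mxtens_index (b, c)).
    by apply: val_inj; rewrite /= mulnDl mulnA addnA.
  by rewrite !mxtens_indexK.
have [i1 i2 i3] := unindexA i; have [j1 j2 j3] := unindexA j.
by rewrite !mxE i1 i2 i3 j1 j2 j3 mulrA.
Qed.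

Definition Mop (X : 'M[C]_(d * (d * d))) : 'M[C]_d :=
  ptracel ((Omega *t (1%:M : 'M[C]_d)) *m reassoc X).

Definition Pstar (X : 'M[C]_(d * (d * d))) : 'M[C]_d :=
  (\tr X / d%:R - \tr (Mop X)) *: 1%:M + d%:R *: Mop X.

Fact Mop_is_linear : linear Mop.
Proof.
move=> a X Y; apply/matrixP => k l.
have reassocP : reassoc (a *: X + Y) = a *: reassoc X + reassoc Y.
  by apply/matrixP => i j; rewrite !(castmxE, mxE).
rewrite /Mop reassocP mulmxDr -scalemxAr !mxE !summxE.
by rewrite mulr_sumr -big_split /=; apply: eq_bigr => i _; rewrite !mxE.
Qed.
HB.instance Definition _ :=
  GRing.isLinear.Build C _ _ _ Mop Mop_is_linear.

Fact Pstar_is_linear : linear Pstar.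
Proof.
move=> a X Y; rewrite /Pstar (linearP Mop) !mxtraceD !mxtraceZ.
apply/matrixP => i j; rewrite !mxE; ring.
Qed.
HB.instance Definition _ :=
  GRing.isLinear.Build C _ _ _ Pstar Pstar_is_linear.

End Retrievers.

Arguments overhead1 {R d} S.
Arguments Pstar R d X : clear implicits.

(* Main.v *)
(* Two exact retrievers agree on [X *t (A *t B)] whenever [B] is traceless, since
   the Choi operators of measure-and-prepare channels span these [A *t B]; trace
   preservation then leaves only a traceless operator [Z], the difference of
   their values on [X *t (A *t 1)], undetermined.  Covariance in [V] makes [Z]
   scalar, hence zero: this is uniqueness.

   For the norm, write [Pstar] as a signed sum of Kraus terms: positive and
   negative parts together give the upper bound on the diamond norm.  For the
   lower bound, feed an arbitrary exact retriever the maximally entangled state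
   on (S, P1) and (P2, R), and test the output against the unitary [2 w - 1],
   where [w] is the maximally entangled projector on (R, S').  The outcome only
   involves [\sum_i \sum_j <i|P(X *t (A *t |i><j|))|j>], in which [Z] contributes
   its trace, so it is the same for every exact retriever, and for [Pstar] it
   equals the upper bound. *)
From HB Require Import structures.
Require Import Defs.
From mathcomp Require Import all_boot all_order all_algebra.
From mathcomp Require Import fingroup perm sesquilinear spectral.
From mathcomp Require Import all_classical all_reals ereal.
From mathcomp Require Import complex mxtens ring lra.

Set Implicit Arguments.
Unset Strict Implicit.
Unset Printing Implicit Defensive.

Import Order.TTheory GRing.Theory Num.Theory.

Local Open Scope classical_set_scope.
Local Open Scope ring_scope.
Local Open Scope sesquilinear_scope.

(** * Tensor products and superoperators *)

Section TensorAlgebra.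
Variable F : comPzRingType.

Lemma big_mxtens m n (V : nmodType) (G : 'I_(m * n) -> V) :
  \sum_k G k = \sum_i \sum_j G (mxtens_index (i, j)).
Proof.
rewrite pair_big /= (reindex (@mxtens_index m n)) /=; first by apply: eq_bigr => -[].
by exists (@mxtens_unindex m n) => k _; rewrite (mxtens_indexK, mxtens_unindexK).
Qed.

Lemma sum_unit (V : nmodType) (G : unit -> V) : \sum_i G i = G tt.
Proof. by rewrite (bigD1 tt) //= big1 ?addr0 // => -[]. Qed.

Lemma mxtens_index_inj m n : injective (@mxtens_index m n).
Proof. exact: can_inj (@mxtens_indexK m n). Qed.

Lemma mxtens_index_eq m n (i i' : 'I_m) (j j' : 'I_n) :
  (mxtens_index (i, j) == mxtens_index (i', j')) = (i == i') && (j == j').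
Proof. by rewrite (inj_eq (@mxtens_index_inj m n)) xpair_eqE. Qed.

Lemma matrix_tensP m n p q (A B : 'M[F]_(m * n, p * q)) :
  (forall i j k l, A (mxtens_index (i, j)) (mxtens_index (k, l))
                 = B (mxtens_index (i, j)) (mxtens_index (k, l))) -> A = B.
Proof.
move=> eqAB; apply/matrixP => x y.
by case: (mxtens_indexP x) => i j; case: (mxtens_indexP y) => k l.
Qed.

Lemma tensmxDl m n p q (A A' : 'M[F]_(m, n)) (B : 'M[F]_(p, q)) :
  (A + A') *t B = A *t B + A' *t B.
Proof. by apply/matrixP => i j; rewrite !mxE mulrDl. Qed.

Lemma tensmxDr m n p q (A : 'M[F]_(m, n)) (B B' : 'M[F]_(p, q)) :
  A *t (B + B') = A *t B + A *t B'.
Proof. by apply/matrixP => i j; rewrite !mxE mulrDr. Qed.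

Lemma tensmxZl m n p q a (A : 'M[F]_(m, n)) (B : 'M[F]_(p, q)) :
  (a *: A) *t B = a *: (A *t B).
Proof. by apply/matrixP => i j; rewrite !mxE mulrA. Qed.

Lemma tensmxZr m n p q a (A : 'M[F]_(m, n)) (B : 'M[F]_(p, q)) :
  A *t (a *: B) = a *: (A *t B).
Proof. by apply/matrixP => i j; rewrite !mxE mulrCA. Qed.

Lemma tensmx_suml I (r : seq I) m n p q (A : I -> 'M[F]_(m, n)) (B : 'M[F]_(p, q)) :
  (\sum_(i <- r) A i) *t B = \sum_(i <- r) A i *t B.
Proof.
apply/matrixP => i j; rewrite mxE !summxE mulr_suml.
by apply: eq_bigr => k _; rewrite mxE.
Qed.

Lemma tensmx_sumr I (r : seq I) m n p q (A : 'M[F]_(m, n)) (B : I -> 'M[F]_(p, q)) :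
  A *t (\sum_(i <- r) B i) = \sum_(i <- r) A *t B i.
Proof.
apply/matrixP => i j; rewrite mxE !summxE mulr_sumr.
by apply: eq_bigr => k _; rewrite mxE.
Qed.

Lemma mxtrace_tens m n (A : 'M[F]_m) (B : 'M[F]_n) : \tr (A *t B) = \tr A * \tr B.
Proof.
rewrite /mxtrace big_mxtens mulr_suml; apply: eq_bigr => i _.
by rewrite mulr_sumr; apply: eq_bigr => j _; rewrite tensmxE.
Qed.

Lemma tens_delta_mx m n p q (i : 'I_m) (j : 'I_n) (k : 'I_p) (l : 'I_q) :
  delta_mx i k *t delta_mx j l
    = delta_mx (mxtens_index (i, j)) (mxtens_index (k, l)) :> 'M[F]_(_, _).
Proof.
apply: matrix_tensP => i' j' k' l'; rewrite tensmxE !mxE !mxtens_index_eq -natrM mulnb.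
by congr (_%:R); congr nat_of_bool; rewrite andbACA.
Qed.

Lemma tens_scalar_mx1 m n : (1%:M *t 1%:M : 'M[F]_(m * n)) = 1%:M.
Proof.
by apply: matrix_tensP => i j k l; rewrite tensmxE !mxE mxtens_index_eq -natrM mulnb.
Qed.

Lemma delta_mulmxE m n p (A : 'M[F]_(n, p)) (i : 'I_m) j k l :
  (delta_mx i j *m A) k l = (k == i)%:R * A j l.
Proof.
rewrite mxE (bigD1 j) //= big1 ?addr0 ?mxE ?eqxx ?andbT // => x xj.
by rewrite mxE (negPf xj) andbF mul0r.
Qed.

Lemma mulmx_deltaE m n p (A : 'M[F]_(m, n)) i (j : 'I_p) k l :
  (A *m delta_mx i j) k l = A k i * (l == j)%:R.
Proof.
rewrite mxE (bigD1 i) //= big1 ?addr0 ?mxE ?eqxx ?andbT // => x xi.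
by rewrite mxE (negPf xi) mulr0.
Qed.

Lemma mxtrace_mul_delta n (A : 'M[F]_n) i j : \tr (delta_mx i j *m A) = A j i.
Proof.
rewrite /mxtrace (bigD1 i) //= big1 ?addr0 => [|k ki]; rewrite !mxE.
  rewrite (bigD1 j) //= big1 ?addr0 => [|l lj]; rewrite !mxE ?eqxx ?mul1r //.
  by rewrite (negPf lj) andbF mul0r.
by rewrite big1 // => l _; rewrite mxE (negPf ki) mul0r.
Qed.

Lemma linear_delta_ext m n (V : lmodType F) (f g : {linear 'M[F]_(m, n) -> V}) :
  (forall i j, f (delta_mx i j) = g (delta_mx i j)) -> f =1 g.
Proof.
move=> fg A; rewrite [A]matrix_sum_delta !linear_sum; apply: eq_bigr => i _.
by rewrite !linear_sum; apply: eq_bigr => j _; rewrite !linearZ fg.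
Qed.

(** Matrix units of the product space are tensors of matrix units. The maps are bare functions with
    linearity hypotheses, so that composite expressions need not be bundled beforehand. *)
Lemma linear_tens_ext m n (V : lmodType F) (f g : 'M[F]_(m * n) -> V) :
  linear f -> linear g -> (forall A B, f (A *t B) = g (A *t B)) -> f =1 g.
Proof.
move=> lf lg fg.
pose mf := GRing.isLinear.Build _ _ _ _ f lf.
pose mg := GRing.isLinear.Build _ _ _ _ g lg.
pose f' : {linear 'M[F]_(m * n) -> V} := HB.pack f mf.
pose g' : {linear 'M[F]_(m * n) -> V} := HB.pack g mg.
apply: (@linear_delta_ext _ _ _ f' g') => x y.
case: (mxtens_indexP x) => i j; case: (mxtens_indexP y) => k l.
by rewrite -tens_delta_mx; apply: fg.
Qed.

Lemma linear_tens3_ext m n p (V : lmodType F) (f g : 'M[F]_(m * (n * p)) -> V) :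
  linear f -> linear g ->
  (forall A B D, f (A *t (B *t D)) = g (A *t (B *t D))) -> f =1 g.
Proof.
move=> lf lg fg; apply: linear_tens_ext => // A.
apply: linear_tens_ext => [a B D|a B D|//].
  by rewrite tensmxDr tensmxZr lf.
by rewrite tensmxDr tensmxZr lg.
Qed.

End TensorAlgebra.

(** * Adjoints, blocks, ampliations and Choi operators *)

Section Superoperators.
Variable R : realType.
Local Notation C := R[i].

Lemma hermsymmxP n (A : 'M[C]_n) : reflect (A ^t* = A) (A \is hermsymmx).
Proof.
by rewrite is_hermitianmxE expr0 scale1r eq_sym; apply: eqP.
Qed.

Lemma adjmx_mul m n p (A : 'M[C]_(m, n)) (B : 'M[C]_(n, p)) :
  (A *m B) ^t* = B ^t* *m A ^t*.
Proof. by rewrite trmx_mul map_mxM. Qed.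

Lemma adjmx_tens m n p q (A : 'M[C]_(m, n)) (B : 'M[C]_(p, q)) :
  (A *t B) ^t* = A ^t* *t B ^t*.
Proof. by rewrite trmx_tens map_mxT. Qed.

Lemma adjmxZ m n a (A : 'M[C]_(m, n)) : (a *: A) ^t* = a^* *: A ^t*.
Proof. by apply/matrixP => i j; rewrite !mxE rmorphM. Qed.

Lemma mxtens_blockE m n (X : 'M[C]_(m * n)) i j k l :
  mxtens_block X i j k l = X (mxtens_index (i, k)) (mxtens_index (j, l)).
Proof. by rewrite mxE. Qed.

Lemma mxtens_block_tens m n (A : 'M[C]_m) (B : 'M[C]_n) i j :
  mxtens_block (A *t B) i j = A i j *: B.
Proof. by apply/matrixP => k l; rewrite mxtens_blockE tensmxE mxE. Qed.

Lemma mxtens_block_linear m n i j : linear (fun X : 'M[C]_(m * n) => mxtens_block X i j).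
Proof. by move=> a X Y; apply/matrixP => k l; rewrite !mxE. Qed.

Lemma mxtens_block_sum I (r : seq I) m n (X : I -> 'M[C]_(m * n)) i j :
  mxtens_block (\sum_(a <- r) X a) i j = \sum_(a <- r) mxtens_block (X a) i j.
Proof. by apply/matrixP => k l; rewrite mxE !summxE; apply: eq_bigr => a _; rewrite mxE. Qed.

Lemma ptracel_tens m n (A : 'M[C]_m) (B : 'M[C]_n) : ptracel (A *t B) = \tr A *: B.
Proof.
rewrite /ptracel /mxtrace scaler_suml; apply: eq_bigr => i _.
exact: mxtens_block_tens.
Qed.

Lemma ampliation_linear r m n (f : superop R m n) : linear (@ampliation R r m n f).
Proof.
move=> a X Y; rewrite /ampliation scaler_sumr -big_split; apply: eq_bigr => i _.
rewrite scaler_sumr -big_split; apply: eq_bigr => j _ /=.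
by rewrite mxtens_block_linear linearP tensmxDr tensmxZr.
Qed.

HB.instance Definition _ r m n (f : superop R m n) :=
  GRing.isLinear.Build C _ _ _ (@ampliation R r m n f) (@ampliation_linear r m n f).

Lemma ampliation_tens r m n (f : superop R m n) (A : 'M[C]_r) B :
  ampliation f (A *t B) = A *t f B.
Proof.
rewrite /ampliation [in RHS](matrix_sum_delta A) tensmx_suml.
apply: eq_bigr => i _; rewrite tensmx_suml; apply: eq_bigr => j _.
by rewrite mxtens_block_tens linearZ tensmxZr tensmxZl.
Qed.

Lemma mxtrace_delta n (i j : 'I_n) : \tr (delta_mx i j : 'M[C]_n) = (i == j)%:R.
Proof. by rewrite -(mulmx1 (delta_mx i j)) mxtrace_mul_delta mxE eq_sym. Qed.

Lemma sum_delta_mul n (i : 'I_n) (G : 'I_n -> C) : \sum_j (i == j)%:R * G j = G i.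
Proof.
rewrite (bigD1 i) //= big1 ?eqxx ?mul1r ?addr0 // => j ji.
by rewrite eq_sym (negPf ji) mul0r.
Qed.

Lemma sum_delta_mx_mul m n (i : 'I_m) (j : 'I_n) (B : 'M[C]_(m, n)) :
  \sum_k \sum_l (delta_mx i j : 'M[C]_(m, n)) k l * B k l = B i j.
Proof.
rewrite -(sum_delta_mul i (fun k => B k j)); apply: eq_bigr => k _.
rewrite -(sum_delta_mul j (fun l => B k l)) mulr_sumr; apply: eq_bigr => l _.
by rewrite mxE mulrA -natrM mulnb [k == i]eq_sym [l == j]eq_sym.
Qed.

Lemma mxtrace_ampliation r m n (f : superop R m n) (X : 'M[C]_(r * m)) :
  trace_preserving f -> \tr (ampliation f X) = \tr X.
Proof.
move=> tpf; rewrite /ampliation linear_sum [in RHS]/mxtrace big_mxtens.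
apply: eq_bigr => i _; rewrite linear_sum /=.
under eq_bigr => j _ do rewrite mxtrace_tens tpf mxtrace_delta.
by rewrite sum_delta_mul; apply: eq_bigr => k _; rewrite mxE.
Qed.

Lemma conj_linear m n (K : 'M[C]_(n, m)) (L : 'M[C]_(m, n)) a :
  linear (fun X : 'M[C]_m => a *: (K *m X *m L)).
Proof.
move=> b X Y; rewrite mulmxDr mulmxDl -scalemxAr -scalemxAl scalerDr !scalerA.
by rewrite mulrC.
Qed.

(** Both sides are linear, so product operators suffice, and there the identity leg passes through
    each Kraus term. The coefficients are arbitrary scalars, which admits signed decompositions. *)
Lemma ampliation_kraus (I : finType) r m n (f : superop R m n) (c : I -> C)
    (K : I -> 'M[C]_(n, m)) :
  (forall X, f X = \sum_a c a *: (K a *m X *m (K a) ^t*)) ->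
  forall X : 'M[C]_(r * m), ampliation f X =
    \sum_a c a *: ((1%:M *t K a) *m X *m (1%:M *t K a) ^t*).
Proof.
move=> fE; apply: linear_tens_ext; first exact: ampliation_linear.
  move=> b X Y; rewrite scaler_sumr -big_split; apply: eq_bigr => a _ /=.
  exact: conj_linear.
move=> A B; rewrite ampliation_tens fE tensmx_sumr; apply: eq_bigr => a _.
rewrite tensmxZr adjmx_tens !tensmx_mul trmx1 map_mx1 mul1mx mulmx1.
by [].
Qed.

(** Block [(k, l)] of the Choi operator is [f (delta_mx k l)]. Multiplying by [N] on one side
    recombines these blocks as if the matrix unit were multiplied by [N^T] on that side, while [W]
    acts on the values. *)
Lemma choi_tens_comm m n (f : superop R m n) (N : 'M[C]_m) (W : 'M[C]_n) :
  comm_mx (choi f) (N *t W) <-> (forall X, f (X *m N^T) *m W = W *m f (N^T *m X)).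
Proof.
have blockl k l : mxtens_block (choi f *m (N *t W)) k l = f (delta_mx k l *m N^T) *m W.
  rewrite [delta_mx k l *m _]matrix_sum_delta linear_sum mulmx_suml /choi mulmx_suml.
  rewrite mxtens_block_sum; apply: eq_bigr => i _.
  rewrite linear_sum mulmx_suml mulmx_suml mxtens_block_sum.
  apply: eq_bigr => j _; rewrite tensmx_mul /= mxtens_block_tens linearZ -scalemxAl.
  by rewrite !delta_mulmxE mxE eq_sym.
have blockr k l : mxtens_block ((N *t W) *m choi f) k l = W *m f (N^T *m delta_mx k l).
  rewrite [_ *m delta_mx k l]matrix_sum_delta [f _]linear_sum mulmx_sumr /choi mulmx_sumr.
  rewrite mxtens_block_sum; apply: eq_bigr => i _.
  rewrite [f _]linear_sum !mulmx_sumr mxtens_block_sum.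
  apply: eq_bigr => j _; rewrite tensmx_mul /= mxtens_block_tens linearZ -scalemxAr.
  by rewrite !mulmx_deltaE mxE eq_sym.
split=> [comm X|fNW].
  pose lhs := fun X => f (X *m N^T) *m W; pose rhs := fun X => W *m f (N^T *m X).
  have lhsP : linear lhs.
    by move=> a Y Z; rewrite /lhs mulmxDl -scalemxAl linearP mulmxDl -scalemxAl.
  have rhsP : linear rhs.
    by move=> a Y Z; rewrite /rhs mulmxDr -scalemxAr linearP mulmxDr -scalemxAr.
  pose mf := GRing.isLinear.Build _ _ _ _ lhs lhsP.
  pose mg := GRing.isLinear.Build _ _ _ _ rhs rhsP.
  pose f' : superop R m n := HB.pack lhs mf.
  pose g' : superop R m n := HB.pack rhs mg.
  apply: (@linear_delta_ext _ _ _ _ f' g') => k l.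
  by rewrite /= /lhs /rhs -blockl comm blockr.
by apply: matrix_tensP => i k j l; rewrite -!mxtens_blockE blockl blockr fNW.
Qed.

Lemma mxtrace_choi_state m n (f : superop R m n) :
  m%:R != 0 :> C -> trace_preserving f -> \tr (choi_state f) = 1.
Proof.
move=> m0 tpf; rewrite mxtraceZ /choi linear_sum /=.
rewrite (eq_bigr (fun=> 1)) => [|i _]; first by rewrite sumr_const card_ord mulVf.
rewrite linear_sum /=; under eq_bigr => j _ do rewrite mxtrace_tens tpf !mxtrace_delta.
by rewrite sum_delta_mul eqxx.
Qed.

End Superoperators.

(** * The retriever [Pstar] *)

Section PstarStructure.
Variables (R : realType) (d : nat).
Local Notation C := R[i].
Implicit Types X : 'M[C]_(d * (d * d)).

(* [\sum_a <a|<a| (x) 1], so that [Mop X] is [bellmx *m X *m bellmx^t*]. *)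
Definition bellmx : 'M[C]_(d, d * (d * d)) :=
  \matrix_(k, n) (((mxtens_unindex n).1 == (mxtens_unindex (mxtens_unindex n).2).1)
                  && ((mxtens_unindex (mxtens_unindex n).2).2 == k))%:R.
Local Notation T := bellmx.

Lemma bellmxE k a b c :
  T k (mxtens_index (a, mxtens_index (b, c))) = ((a == b) && (c == k))%:R.
Proof. by rewrite mxE !mxtens_indexK /= ?mxtens_indexK. Qed.

Lemma bellmx_mulE p (Y : 'M[C]_(_, p)) k l :
  (T *m Y) k l = \sum_a Y (mxtens_index (a, mxtens_index (a, k))) l.
Proof.
rewrite mxE big_mxtens; apply: eq_bigr => a _; rewrite big_mxtens.
rewrite (bigD1 a) //= [X in _ + X]big1 ?addr0 => [|b ba].
  rewrite (bigD1 k) //= big1 ?addr0 => [|c ck]; rewrite bellmxE.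
    by rewrite !eqxx mul1r.
  by rewrite (negPf ck) andbF mul0r.
by rewrite big1 // => c _; rewrite bellmxE eq_sym (negPf ba) mul0r.
Qed.

Lemma bellmx_adjE n k : T^t* n k = T k n.
Proof. by rewrite !mxE rmorph_nat. Qed.

Lemma mul_bellmx_adjE p (Y : 'M[C]_(p, _)) k l :
  (Y *m T^t*) k l = \sum_a Y k (mxtens_index (a, mxtens_index (a, l))).
Proof.
transitivity ((T *m Y^T) l k).
  by rewrite [LHS]mxE [RHS]mxE; apply: eq_bigr => n _; rewrite bellmx_adjE mulrC [Y^T _ _]mxE.
by rewrite bellmx_mulE; apply: eq_bigr => a _; rewrite mxE.
Qed.

Lemma bellmxK : T *m T^t* = d%:R%:M.
Proof.
apply/matrixP => k l; rewrite mul_bellmx_adjE.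
under eq_bigr => a _ do rewrite bellmxE eqxx.
by rewrite sumr_const card_ord mxE eq_sym; case: eqP => _; rewrite ?mul0rn.
Qed.

Lemma bellmx_tens (A B D : 'M[C]_d) :
  T *m (A *t (B *t D)) *m T^t* = (\sum_i \sum_j A i j * B i j) *: D.
Proof.
apply/matrixP => k l; rewrite mul_bellmx_adjE mxE exchange_big mulr_suml.
apply: eq_bigr => a _; rewrite bellmx_mulE mulr_suml; apply: eq_bigr => b _.
by rewrite !tensmxE mulrA.
Qed.

Lemma mxtrace_Omega_tens (A B : 'M[C]_d) :
  \tr (Omega R d *m (A *t B)) = \sum_i \sum_j A i j * B i j.
Proof.
rewrite /Omega mulmx_suml linear_sum [in RHS]exchange_big; apply: eq_bigr => i _.
rewrite mulmx_suml linear_sum; apply: eq_bigr => j _ /=.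
by rewrite tensmx_mul mxtrace_tens !mxtrace_mul_delta.
Qed.

Lemma Mop_tens (A B D : 'M[C]_d) :
  Mop (A *t (B *t D)) = (\sum_i \sum_j A i j * B i j) *: D.
Proof.
by rewrite /Mop reassoc_tens tensmx_mul ptracel_tens mul1mx mxtrace_Omega_tens.
Qed.

Lemma MopE X : Mop X = T *m X *m T^t*.
Proof.
apply: (@linear_tens3_ext _ _ _ _ _ (@Mop R d) (fun X => T *m X *m T^t*)) => [||A B D].
- exact: linearP.
- by move=> a Y Z; rewrite mulmxDr mulmxDl -scalemxAr -scalemxAl.
- by rewrite Mop_tens bellmx_tens.
Qed.

(** Transpose trick for the maximally entangled vector: moving [A] across the contracted pair turns
    [A *t B] into [A^T *m B], here the identity, so only [V] remains. *)
Lemma bellmx_intertwine (A B V : 'M[C]_d) :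
  A^T *m B = 1%:M -> T *m (A *t (B *t V)) = V *m T.
Proof.
move=> AB; apply/matrixP => k n; case: (mxtens_indexP n) => a m.
case: (mxtens_indexP m) => b c; rewrite bellmx_mulE.
under eq_bigr => i _ do rewrite !tensmxE mulrA.
rewrite -mulr_suml [in RHS]mxE [in RHS](bigD1 c) //=.
rewrite [in RHS]big1 ?addr0 => [|e ec]; rewrite bellmxE.
  have -> : \sum_i A i a * B i b = (A^T *m B) a b.
    by rewrite mxE; apply: eq_bigr => i _; rewrite mxE.
  by rewrite AB mxE eqxx andbT mulrC.
by rewrite [c == e]eq_sym (negPf ec) andbF mulr0.
Qed.

(** In the form given by [choi_tens_comm], [N^T] slides through [T] on either side and becomes
    [V^T], which [W] cancels; the trace terms agree by cyclicity. *)
Lemma covariant_Pstar : covariant (Pstar R d).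
Proof.
move=> U V [/unitarymxP UU _] [/unitarymxP VV _].
have U'U := mulmx1C UU; have V'V := mulmx1C VV.
set W := map_mx Num.conj V; set N := U *t (map_mx Num.conj U *t V).
have VW : V^T *m W = 1%:M.
  by rewrite -[W]trmxK -trmx_mul /W map_trmx V'V trmx1.
have WV := mulmx1C VW.
have NE : N^T = U^T *t (U ^t* *t V^T) by rewrite /N !trmx_tens map_trmx.
have NT : T *m N^T = V^T *m T.
  by rewrite NE; apply: bellmx_intertwine; rewrite trmxK.
have TN : N^T *m T^t* = T^t* *m V^T.
  rewrite -[N^T]trmxCK -[V^T]trmxCK -!adjmx_mul; congr (_ ^t*).
  rewrite NE !adjmx_tens trmxCK; apply: bellmx_intertwine.
  by rewrite map_trmx trmxK U'U.
apply/choi_tens_comm => X; rewrite /= /Pstar !MopE.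
have -> : T *m (X *m N^T) *m T^t* = T *m X *m T^t* *m V^T.
  by rewrite -!mulmxA TN.
have -> : T *m (N^T *m X) *m T^t* = V^T *m (T *m X *m T^t*).
  by rewrite !mulmxA NT.
set M := T *m X *m T^t*.
rewrite [\tr (X *m _)]mxtrace_mulC [\tr (M *m _)]mxtrace_mulC.
rewrite mulmxDl mulmxDr -!scalemxAl -!scalemxAr mul1mx mulmx1.
by rewrite -(mulmxA M) VW mulmx1 (mulmxA W) WV mul1mx.
Qed.

Hypothesis d_gt1 : (1 < d)%N.

Lemma dim_neq0 : d%:R != 0 :> C.
Proof. by rewrite pnatr_eq0 -lt0n ltnW. Qed.

Lemma hptp_Pstar : hptp (Pstar R d).
Proof.
split=> [X /hermsymmxP hX|X]; last first.
  rewrite mxtraceD !mxtraceZ mxtrace1; field.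
  exact: dim_neq0.
apply/hermsymmxP; have hM : (Mop X) ^t* = Mop X.
  by rewrite MopE !adjmx_mul trmxCK hX mulmxA.
have tr_real n (A : 'M[C]_n) : A ^t* = A -> (\tr A)^* = \tr A.
  by move=> {2}<-; rewrite trace_map_mx mxtrace_tr.
rewrite /Pstar raddfD /= map_mxD !adjmxZ trmx1 map_mx1 hM rmorphB rmorphM fmorphV.
by rewrite /= !tr_real // !conjC_nat.
Qed.

(** Contracting [rho] with the [P1] half of the Choi operator reproduces [f rho], so [Mop] returns
    [f rho] divided by [d]. Its trace is then [d^-1], which makes the coefficient of the identity
    vanish. *)
Lemma Pstar_exact (rho : 'M[C]_d) (f : superop R d d) :
  \tr rho = 1 -> trace_preserving f -> Pstar R d (rho *t choi_state f) = f rho.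
Proof.
move=> tr1 tpf; have ME : Mop (rho *t choi_state f) = d%:R^-1 *: f rho.
  rewrite /choi_state /choi tensmxZr tensmx_sumr linearZ linear_sum; congr (_ *: _).
  rewrite [in RHS](matrix_sum_delta rho) linear_sum; apply: eq_bigr => i _.
  rewrite tensmx_sumr !linear_sum; apply: eq_bigr => j _ /=.
  rewrite Mop_tens linearZ; congr (_ *: _).
  under eq_bigr do under eq_bigr do rewrite mulrC.
  exact: sum_delta_mx_mul.
rewrite /Pstar ME mxtraceZ tpf tr1 mxtrace_tens tr1 mxtrace_choi_state ?dim_neq0 //.
by rewrite !mulr1 !mul1r subrr scale0r add0r scalerA mulfV ?scale1r ?dim_neq0.
Qed.

Lemma exact_retriever_Pstar : exact_retriever (cptp R d) (Pstar R d).
Proof.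
split=> [|rho f [_ tr1] [_ tpf]]; first exact: hptp_Pstar.
exact: Pstar_exact.
Qed.

End PstarStructure.

(** * Measure-and-prepare channels *)

Section Channels.
Variable R : realType.
Local Notation C := R[i].

Lemma adjmx_delta m n i j : (delta_mx i j : 'M[C]_(m, n)) ^t* = delta_mx j i.
Proof. by apply/matrixP => k l; rewrite !mxE rmorph_nat andbC. Qed.

Lemma mulmx11 m n (A : 'cV[C]_m) (x : 'M[C]_1) (B : 'rV[C]_n) :
  A *m x *m B = \tr x *: (A *m B).
Proof. by rewrite [x]mx11_scalar mul_mx_scalar mxtrace_scalar -scalemxAl. Qed.

Lemma psdmx_conj m n (K : 'M[C]_(n, m)) (X : 'M[C]_m) :
  psdmx X -> psdmx (K *m X *m K ^t*).
Proof.
move=> [/hermsymmxP hX X_ge0]; split=> [|v].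
  by apply/hermsymmxP; rewrite !adjmx_mul trmxCK hX mulmxA.
by have := X_ge0 (K ^t* *m v); rewrite adjmx_mul trmxCK !mulmxA.
Qed.

Lemma psdmx_sum (I : finType) n (X : I -> 'M[C]_n) :
  (forall a, psdmx (X a)) -> psdmx (\sum_a X a).
Proof.
move=> psdX; split=> [|v].
  apply/hermsymmxP; rewrite raddf_sum map_mx_sum; apply: eq_bigr => a _.
  by apply/hermsymmxP; case: (psdX a).
rewrite mulmx_sumr mulmx_suml summxE; apply: sumr_ge0 => a _.
by case: (psdX a).
Qed.

Lemma psdmx_pure n (v : 'cV[C]_n) : psdmx (v *m v ^t*).
Proof.
split=> [|x]; first by apply/hermsymmxP; rewrite adjmx_mul trmxCK.
rewrite mulmxA -mulmxA -{1}[v]trmxCK -adjmx_mul mxE big_ord1 !mxE mulrC.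
exact: mul_conjC_ge0.
Qed.

Lemma density_pure n (v : 'cV[C]_n) : v ^t* *m v = 1%:M -> density (v *m v ^t*).
Proof.
by move=> v1; split; [exact: psdmx_pure | rewrite mxtrace_mulC v1 mxtrace1].
Qed.

Lemma kraus_completely_positive (I : finType) m n (f : superop R m n)
    (K : I -> 'M[C]_(n, m)) :
  (forall X, f X = \sum_a K a *m X *m (K a) ^t*) -> completely_positive f.
Proof.
move=> fE r X psdX; rewrite (@ampliation_kraus _ I _ _ _ _ (fun=> 1) K) => [|Y].
  apply: psdmx_sum => a; rewrite scale1r; exact: psdmx_conj.
by rewrite fE; apply: eq_bigr => a _; rewrite scale1r.
Qed.

Fact measure_prepare_linear m n (F : 'M[C]_m) (s t : 'M[C]_n) :
  linear (fun X => \tr (F *m X) *: (s - t) + \tr X *: t).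
Proof.
move=> a X Y; rewrite mulmxDr -scalemxAr !mxtraceD !mxtraceZ.
by apply/matrixP => i j; rewrite !mxE; ring.
Qed.

(** Measures the effect [F] and prepares [s] if it occurs, [t] otherwise. Grouping around [s - t],
    which is traceless for states, isolates the useful part of the Choi operator. *)
Definition measure_prepare m n (F : 'M[C]_m) (s t : 'M[C]_n) : superop R m n :=
  HB.pack (fun X => \tr (F *m X) *: (s - t) + \tr X *: t)
    (GRing.isLinear.Build _ _ _ _ _ (measure_prepare_linear F s t)).

Lemma choi_measure_prepare m n (F : 'M[C]_m) (s t : 'M[C]_n) :
  choi (measure_prepare F s t) = F^T *t (s - t) + 1%:M *t t.
Proof.
rewrite [F^T]matrix_sum_delta [1%:M]matrix_sum_delta !tensmx_suml -big_split.
apply: eq_bigr => i _; rewrite !tensmx_suml -big_split; apply: eq_bigr => j _ /=.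
rewrite tensmxDr !tensmxZr !tensmxZl mxtrace_mulC mxtrace_mul_delta.
by rewrite -(mulmx1 (delta_mx i j)) mxtrace_mul_delta !mxE [j == i]eq_sym.
Qed.

(** Complete positivity comes from explicit Kraus operators: [s *m v^t*] for the outcome [v], and
    [t *m (delta_mx 0 k *m G)] over all [k] for the complementary projector [G]. *)
Lemma measure_prepare_cptp d (v s t : 'cV[C]_d) :
  v ^t* *m v = 1%:M -> s ^t* *m s = 1%:M -> t ^t* *m t = 1%:M ->
  cptp R d (measure_prepare (v *m v ^t*) (s *m s ^t*) (t *m t ^t*)).
Proof.
move=> v1 s1 t1; split; last first.
  move=> X /=; rewrite mxtraceD !mxtraceZ linearB /= ![\tr (_ *m _ ^t*)]mxtrace_mulC.
  by rewrite s1 t1 subrr mulr0 add0r mxtrace1 mulr1.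
pose G := 1%:M - v *m v ^t*.
have hG : G ^t* = G.
  by rewrite /G raddfB /= map_mxB trmx1 map_mx1 adjmx_mul trmxCK.
have GG : G *m G = G.
  rewrite {2}/G mulmxBr mulmx1 mulmxA {2}/G mulmxBl mul1mx -(mulmxA v) v1 mulmx1 subrr.
  by rewrite mul0mx subr0.
pose K (a : unit + 'I_d) : 'M[C]_d :=
  if a is inr k then t *m (delta_mx 0 k *m G) else s *m v ^t*.
apply: (@kraus_completely_positive _ _ _ _ K) => X.
rewrite big_sumType /= sum_unit /=.
have -> : \sum_i t *m (delta_mx 0 i *m G) *m X *m (t *m (delta_mx 0 i *m G))^t*
          = \tr (G *m X) *: (t *m t^t*).
  have -> : \tr (G *m X) = \tr (G *m X *m G) by rewrite [RHS]mxtrace_mulC mulmxA GG.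
  rewrite /mxtrace scaler_suml; apply: eq_bigr => i _.
  rewrite !adjmx_mul hG adjmx_delta.
  transitivity (t *m (delta_mx 0 i *m (G *m X *m G) *m delta_mx i 0) *m t^t*).
    by rewrite !mulmxA.
  by rewrite mulmx11 trace_mx11 mulmx_deltaE delta_mulmxE !eqxx mul1r mulr1.
have -> : s *m v^t* *m X *m (s *m v^t*)^t* = \tr (v *m v^t* *m X) *: (s *m s^t*).
  have -> : \tr (v *m v^t* *m X) = \tr (v^t* *m X *m v).
    by rewrite -mulmxA mxtrace_mulC.
  by rewrite -mulmx11 adjmx_mul trmxCK !mulmxA.
rewrite /G mulmxBl mul1mx raddfB /=.
by apply/matrixP => i j; rewrite !mxE /=; ring.
Qed.

(** Pure states span all matrices. By rescaling, the difference [h] vanishes on every [v *m v^t*],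
    and polarization carries this to the matrix units. *)
Lemma linear_pure_ext n (V : lmodType C) (f g : 'M[C]_n -> V) :
  linear f -> linear g ->
  (forall v : 'cV_n, v ^t* *m v = 1%:M -> f (v *m v ^t*) = g (v *m v ^t*)) -> f =1 g.
Proof.
move=> lf lg fg.
have [h hfg] : exists h : {linear 'M[C]_n -> V}, forall X, h X = f X - g X.
  have lh : linear (fun X => f X - g X).
    by move=> a X Y; rewrite lf lg scalerBr opprD addrACA.
  by exists (HB.pack_for {linear 'M[C]_n -> V} (fun X => f X - g X)
    (GRing.isLinear.Build _ _ _ _ _ lh)).
suff h0 : h =1 (\0 : {linear 'M[C]_n -> V}).
  by move=> X; apply/eqP; rewrite -subr_eq0 -hfg h0.
have hpure (v : 'cV_n) : h (v *m v^t*) = 0.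
  have [->|v0] := eqVneq v 0; first by rewrite mul0mx linear0.
  have nv : 0 < (v^t* *m v) 0 0.
    rewrite lt_def; apply/andP; split; last first.
      by rewrite mxE; apply: sumr_ge0 => i _; rewrite !mxE mulrC mul_conjC_ge0.
    apply: contra v0; rewrite mxE psumr_eq0 => [/allP z|i _]; last first.
      by rewrite !mxE mulrC mul_conjC_ge0.
    apply/eqP/matrixP => i j; rewrite ord1 mxE; apply/eqP.
    by have := z i (mem_index_enum i); rewrite !mxE mulrC mul_conjC_eq0.
  set a := sqrtC ((v^t* *m v) 0 0); have a0 : 0 < a by rewrite sqrtC_gt0.
  have ar : a^* = a by apply: CrealP; rewrite gtr0_real.
  have -> : v *m v^t* = (a * a) *: ((a^-1 *: v) *m (a^-1 *: v)^t*).
    rewrite adjmxZ fmorphV /= ar -scalemxAl -scalemxAr !scalerA.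
    by rewrite mulfK ?divff ?scale1r // gt_eqF.
  rewrite linearZ /= hfg fg ?subrr ?scaler0 //.
  rewrite adjmxZ fmorphV /= ar -scalemxAl -scalemxAr !scalerA -invfM.
  rewrite [v^t* *m v]mx11_scalar scale_scalar_mx -[X in (_ * X)%:M]sqrtCK -/a.
  by rewrite expr2 mulVf // mulf_neq0 // gt_eqF.
apply: linear_delta_ext => i j /=.
(* At [c = 1] and [c = 'i] this gives two independent relations between the values of [h] at
   [delta_mx i j] and [delta_mx j i], which force both to vanish. *)
have hE (c : C) : h ((delta_mx i 0 + c *: delta_mx j 0) *m
    (delta_mx i 0 + c *: delta_mx j 0 : 'cV_n)^t*)
    = c^* *: h (delta_mx i j) + c *: h (delta_mx j i).
  rewrite raddfD /= map_mxD adjmxZ !adjmx_delta mulmxDl !mulmxDr.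
  rewrite -!scalemxAl -!scalemxAr !mul_delta_mx !linearD !linearZ /=.
  have hd k : h (delta_mx k k) = 0.
    by have := hpure (delta_mx k 0); rewrite adjmx_delta mul_delta_mx.
  by rewrite !hd !scaler0 add0r addr0.
have e1 := hE 1; rewrite hpure rmorph1 !scale1r in e1.
have e2 := hE 'i; rewrite hpure in e2.
rewrite conjCi in e2.
have eji : h (delta_mx j i) = - h (delta_mx i j).
  by apply/eqP; rewrite -addr_eq0 addrC -e1.
move: e2; rewrite eji scalerN scaleNr -opprD => /eqP.
rewrite eq_sym oppr_eq0 -scalerDr scaler_eq0 (negPf (neq0Ci _)) /=.
by rewrite -mulr2n -scaler_nat scaler_eq0 pnatr_eq0 => /eqP.
Qed.

End Channels.

(** * Exact retrievers *)

Section ExactRetrievers.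
Variables (R : realType) (d : nat).
Local Notation C := R[i].
Hypothesis d_gt1 : (1 < d)%N.
Implicit Types P Q : superop R (d * (d * d)) d.

Let i0 : 'I_d := Ordinal (ltnW d_gt1).

Let retriever_lin1 P A B : linear (fun X : 'M[C]_d => P (X *t (A *t B))).
Proof. by move=> a X Y; rewrite tensmxDl tensmxZl linearP. Qed.

Let retriever_lin2 P X B : linear (fun A : 'M[C]_d => P (X *t (A^T *t B))).
Proof.
move=> a A A'.
by rewrite linearP /= tensmxDl tensmxZl tensmxDr tensmxZr linearP.
Qed.

(** When [\tr T = 1], the operator [B - \tr B *: T] is [B] itself for traceless [B] and a difference
    of states for a state [B]. Agreement on differences of states thus becomes a linear statement in
    [B]. *)
Let retriever_lin3 P X A T :
  linear (fun B : 'M[C]_d => P (X *t (A *t (B - \tr B *: T)))).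
Proof.
move=> a B B'; rewrite linearP /= scalerDl opprD addrACA -scalerA -scalerBr.
by rewrite !tensmxDr !tensmxZr !tensmxDr linearP.
Qed.

(* The Choi operators of measure-and-prepare channels
   [F^T *t (s - t) + 1 *t t] span [A *t B] for all [A] and all traceless [B]. *)
Lemma exact_retriever_traceless P Q (X A B : 'M[C]_d) :
  exact_retriever (cptp R d) P -> exact_retriever (cptp R d) Q -> \tr B = 0 ->
  P (X *t (A *t B)) = Q (X *t (A *t B)).
Proof.
move=> [_ exP] [_ exQ] trB.
have choiPQ (r v s t : 'cV[C]_d) : r^t* *m r = 1%:M -> v^t* *m v = 1%:M ->
    s^t* *m s = 1%:M -> t^t* *m t = 1%:M ->
    let c := (v *m v^t*)^T *t (s *m s^t* - t *m t^t*) + 1%:M *t (t *m t^t*) in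
    P (r *m r^t* *t c) = Q (r *m r^t* *t c).
  move=> r1 v1 s1 t1 c; have mpC := measure_prepare_cptp v1 s1 t1.
  have d0 : d%:R^-1 != 0 :> C by rewrite invr_eq0 dim_neq0.
  apply: (scalerI d0); rewrite -!linearZ -!tensmxZr /c -choi_measure_prepare.
  by rewrite exP ?exQ //; apply: density_pure.
have purePQ (r v s t : 'cV[C]_d) : r^t* *m r = 1%:M -> v^t* *m v = 1%:M ->
    s^t* *m s = 1%:M -> t^t* *m t = 1%:M ->
    P (r *m r^t* *t ((v *m v^t*)^T *t (s *m s^t* - t *m t^t*)))
    = Q (r *m r^t* *t ((v *m v^t*)^T *t (s *m s^t* - t *m t^t*))).
  move=> r1 v1 s1 t1; have /= := choiPQ _ _ _ _ r1 v1 t1 t1.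
  rewrite subrr tensmx0 add0r => PQ1; have /= := choiPQ _ _ _ _ r1 v1 s1 t1.
  by rewrite tensmxDr !linearD /= PQ1 => /addIr.
pose t := delta_mx i0 0 : 'cV[C]_d.
have t1 : t^t* *m t = 1%:M.
  rewrite adjmx_delta mul_delta_mx; apply/matrixP => i j.
  by rewrite !ord1 !mxE.
(* The goal is reduced to pure states one tensor factor at a time: [B], then [A], transposed to
   match the Choi operators, then [X]. *)
have := linear_pure_ext (@retriever_lin3 P X A (t *m t^t*))
  (@retriever_lin3 Q X A (t *m t^t*)).
move=> /(_ _ B); rewrite trB scale0r subr0; apply=> s s1.
rewrite mxtrace_mulC s1 mxtrace1 scale1r -[A]trmxK.
have := linear_pure_ext (@retriever_lin2 P X (s *m s^t* - t *m t^t*))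
  (@retriever_lin2 Q X (s *m s^t* - t *m t^t*)).
apply=> v v1.
have := linear_pure_ext (@retriever_lin1 P (v *m v^t*)^T (s *m s^t* - t *m t^t*))
  (@retriever_lin1 Q (v *m v^t*)^T (s *m s^t* - t *m t^t*)).
by apply=> r r1; apply: purePQ.
Qed.

(** Splitting [B] into a traceless part and a multiple of the identity leaves only the values at the
    identity free; trace preservation of both maps makes their difference traceless. *)
Lemma exact_retriever_diff P Q (X A : 'M[C]_d) :
  exact_retriever (cptp R d) P -> exact_retriever (cptp R d) Q ->
  let Z := d%:R^-1 *: (P (X *t (A *t 1%:M)) - Q (X *t (A *t 1%:M))) in
  \tr Z = 0 /\ forall B, P (X *t (A *t B)) = Q (X *t (A *t B)) + \tr B *: Z.
Proof.
move=> exP exQ Z; have d0 := dim_neq0 R d_gt1; split.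
  rewrite mxtraceZ raddfB /=; case: exP => -[_ ->] _; case: exQ => -[_ ->] _.
  by rewrite subrr mulr0.
move=> B; pose B0 := B - (\tr B / d%:R) *: 1%:M.
have trB0 : \tr B0 = 0.
  by rewrite raddfB /= mxtraceZ mxtrace1 divfK // subrr.
have splitB (S : superop R (d * (d * d)) d) : S (X *t (A *t B))
    = S (X *t (A *t B0)) + (\tr B / d%:R) *: S (X *t (A *t 1%:M)).
  by rewrite -linearZ -linearD -!tensmxZr -!tensmxDr subrK.
rewrite !splitB (exact_retriever_traceless _ _ exP exQ) // /Z scalerA scalerBr.
by rewrite -addrA [X in _ = _ + X]addrC subrK.
Qed.

Lemma special_unitary_conj (V : 'M[C]_d) :
  special_unitary V -> special_unitary (map_mx Num.conj V).
Proof.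
by move=> [uV detV]; split; rewrite ?conjC_unitary // det_map_mx detV rmorph1.
Qed.

Lemma special_unitary1 : special_unitary (1%:M : 'M[C]_d).
Proof.
by split; [apply/unitarymxP; rewrite trmx1 map_mx1 mulmx1 | rewrite det1].
Qed.

(* Conjugate by [diag('i, -'i, 1, ...)] to kill off-diagonal entries, and by
   signed transpositions to identify the diagonal ones. *)
Lemma special_unitary_comm_scalar (Z : 'M[C]_d) :
  (forall V, special_unitary V -> Z *m V = V *m Z) -> exists z, Z = z%:M.
Proof.
move=> commZ.
have diag_unitary (D : 'rV[C]_d) : (forall i, D 0 i * (D 0 i)^* = 1) ->
    diag_mx D \is unitarymx.
  move=> D1; apply/unitarymxP; rewrite tr_diag_mx map_diag_mx mulmx_diag.
  apply/matrixP => i j; rewrite !mxE; case: eqP => // _; exact: D1.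
have offdiag a b : a != b -> Z a b = 0.
  (* The determinant is ['i * - 'i = 1]. The diagonal entries at [a] and [b] are opposite, so
     commutation gives [2 * 'i * Z a b = 0]. *)
  move=> ab; pose D : 'rV[C]_d := \row_i (if i == a then 'i else if i == b then - 'i else 1).
  have suD : special_unitary (diag_mx D).
    split.
      apply: diag_unitary => i; rewrite !mxE; case: eqP => _.
        by rewrite conjCi mulrN -expr2 sqrCi opprK.
      case: eqP => _; last by rewrite conjC1 mulr1.
      by rewrite rmorphN /= conjCi opprK mulNr -expr2 sqrCi opprK.
    rewrite det_diag (bigD1 a) //= (bigD1 b) /=; last by rewrite eq_sym.
    rewrite big1 ?mulr1 => [|i /andP[ia ib]].
      by rewrite !mxE eqxx eq_sym (negPf ab) eqxx mulrN -expr2 sqrCi opprK.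
    by rewrite mxE (negPf ia) (negPf ib).
  have /matrixP/(_ a b) := commZ _ suD.
  rewrite mul_diag_mx mul_mx_diag !mxE !eqxx [b == a]eq_sym (negPf ab).
  move/eqP; rewrite mulrN mulrC -subr_eq0 -opprD oppr_eq0 -mulr2n -mulr_natr.
  by rewrite !mulf_eq0 (negPf (neq0Ci _)) pnatr_eq0 orbF => /eqP.
have diagE a b : a != b -> Z a a = Z b b.
  (* The entry [-1] compensates for the sign of the transposition, so that the product has
     determinant one. *)
  move=> ab; pose D : 'rV[C]_d := \row_i (if i == a then -1 else 1).
  have suV : special_unitary (diag_mx D *m perm_mx (tperm a b)).
    split.
      apply: mul_unitarymx.
        apply: diag_unitary => i; rewrite mxE; case: eqP => _.
          by rewrite rmorphN rmorph1 mulrNN mulr1.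
        by rewrite rmorph1 mulr1.
      apply/unitarymxP; rewrite tr_perm_mx map_perm_mx -perm_mxM mulgV.
      by rewrite perm_mx1.
    rewrite det_mulmx det_perm odd_tperm ab expr1 det_diag (bigD1 a) //=.
    rewrite big1 ?mulr1 => [|i ia]; first by rewrite mxE eqxx mulrNN mulr1.
    by rewrite mxE (negPf ia).
  have /matrixP/(_ a b) := commZ _ suV.
  rewrite mulmxA -[in LHS](tpermV a b) -col_permE -mulmxA -row_permE mul_mx_diag mul_diag_mx.
  rewrite !mxE. rewrite tpermR tpermL eqxx mulrC => /mulfI; apply.
  by rewrite oppr_eq0 oner_eq0.
exists (Z i0 i0); apply/matrixP => i j; rewrite mxE.
have [<-|ij] := eqVneq i j; last exact: offdiag.
by have [->|/diagE] := eqVneq i i0.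
Qed.

Lemma covariant_retriever_unique P Q :
  covariant P -> covariant Q ->
  exact_retriever (cptp R d) P -> exact_retriever (cptp R d) Q -> P =1 Q.
Proof.
move=> covP covQ exP exQ.
(* Covariance is taken at [U = 1] and at the conjugate of [V]. With [V] inserted in the third slot,
   the input factors cancel on both sides and only commutation of the output with [V] is left. *)
have comm1 (S : superop R (d * (d * d)) d) (X A V : 'M[C]_d) :
    covariant S -> special_unitary V ->
    S (X *t (A *t 1%:M)) *m V = V *m S (X *t (A *t 1%:M)).
  move=> covS suV; have := covS _ _ special_unitary1 (special_unitary_conj suV).
  have V2 : map_mx Num.conj (map_mx Num.conj V) = V.
    by rewrite -map_mx_comp map_mx_id // => x; rewrite /= conjCK.
  rewrite map_mx1 V2 => /choi_tens_comm/(_ (X *t (A *t V))).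
  rewrite !trmx_tens !trmx1 !tensmx_mul !mulmx1 !mul1mx.
  case: suV => /unitarymxP VV _.
  have VV1 : V *m (map_mx Num.conj V)^T = 1%:M by rewrite map_trmx.
  by rewrite VV1 (mulmx1C VV1).
apply: linear_tens3_ext => [||X A B]; try exact: linearP.
have [trZ ->] := exact_retriever_diff X A exP exQ.
set Z := _ *: (_ - _) in trZ *.
suff -> : Z = 0 by rewrite scaler0 addr0.
have [z Zz] : exists z, Z = z%:M.
  apply: special_unitary_comm_scalar => V suV.
  by rewrite /Z -scalemxAl -scalemxAr mulmxBl mulmxBr !comm1.
move: trZ; rewrite Zz mxtrace_scalar -mulr_natr => /eqP.
by rewrite mulf_eq0 (negPf (dim_neq0 R d_gt1)) orbF => /eqP ->; rewrite raddf0.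
Qed.

(** By [exact_retriever_diff] the [(i, j)] terms differ by [(i == j)%:R * Z i j], and these
    differences add up to [\tr Z = 0]. *)
Lemma exact_retriever_swap_trace P Q (X A : 'M[C]_d) :
  exact_retriever (cptp R d) P -> exact_retriever (cptp R d) Q ->
  \sum_i \sum_j \tr (delta_mx j i *m P (X *t (A *t delta_mx i j)))
  = \sum_i \sum_j \tr (delta_mx j i *m Q (X *t (A *t delta_mx i j))).
Proof.
move=> exP exQ; have [trZ PQ] := exact_retriever_diff X A exP exQ.
set Z := _ *: (_ - _) in trZ PQ.
have term i j : \tr (delta_mx j i *m P (X *t (A *t delta_mx i j)))
    = \tr (delta_mx j i *m Q (X *t (A *t delta_mx i j))) + (i == j)%:R * Z i j.
  rewrite PQ mulmxDr -scalemxAr mxtraceD mxtraceZ !mxtrace_mul_delta; congr (_ + _ * _).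
  by rewrite -(mulmx1 (delta_mx i j)) mxtrace_mul_delta mxE eq_sym.
have trZ' : \sum_i Z i i = 0 by [].
rewrite -[RHS]addr0 -[X in _ = _ + X]trZ' -big_split; apply: eq_bigr => i _ /=.
under eq_bigr => j _ do rewrite term.
rewrite big_split; congr (_ + _).
rewrite (bigD1 i) //= big1 ?eqxx ?mul1r ?addr0 // => j ji.
by rewrite eq_sym (negPf ji) mul0r.
Qed.

End ExactRetrievers.

(** * The trace norm *)

Section TraceNorm.
Variable R : realType.
Local Notation C := R[i].
Local Open Scope complex_scope.

Definition sqnorm n (v : 'cV[C]_n) : C := (v ^t* *m v) 0 0.

Lemma sqnormE n (v : 'cV[C]_n) : sqnorm v = \sum_i `|v i 0| ^+ 2.
Proof. by rewrite /sqnorm mxE; apply: eq_bigr => i _; rewrite !mxE normCK mulrC. Qed.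

Lemma sqnorm_ge0 n (v : 'cV[C]_n) : 0 <= sqnorm v.
Proof. by rewrite sqnormE; apply: sumr_ge0 => i _; rewrite exprn_ge0. Qed.

Lemma sqnorm_eq0 n (v : 'cV[C]_n) : sqnorm v = 0 -> v = 0.
Proof.
rewrite sqnormE => /eqP; rewrite psumr_eq0 => [/allP v0|i _]; last by rewrite exprn_ge0.
apply/matrixP => i j; rewrite ord1 mxE; apply/eqP.
by have := v0 i (mem_index_enum i); rewrite /= expf_eq0 normr_eq0.
Qed.

Lemma sqnorm_mul m n (K : 'M[C]_(m, n)) (v : 'cV[C]_n) :
  sqnorm (K *m v) = (v ^t* *m (K ^t* *m K) *m v) 0 0.
Proof. by rewrite /sqnorm adjmx_mul !mulmxA. Qed.

Lemma sqnorm_unitary n (U : 'M[C]_n) (v : 'cV[C]_n) :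
  U \is unitarymx -> sqnorm (U *m v) = sqnorm v.
Proof.
by move=> /unitarymxP/mulmx1C UU; rewrite sqnorm_mul UU mulmx1.
Qed.

(** Weighted Young inequality, termwise from [s^-1 * (s * a - b) ^+ 2 >= 0]. The free weight, later
    set to a singular value, replaces the square roots of Cauchy-Schwarz. *)
Lemma young_dot n (u v : 'cV[C]_n) (s : C) : 0 < s ->
  2 * `|(u ^t* *m v) 0 0| <= s * sqnorm u + s^-1 * sqnorm v.
Proof.
move=> s0; rewrite !sqnormE mxE.
apply: (@le_trans _ _ (2 * \sum_i `|u i 0| * `|v i 0|)).
  rewrite ler_wpM2l //; apply: le_trans (ler_norm_sum _ _ _) _.
  by apply: ler_sum => i _; rewrite normrM !mxE norm_conjC.
rewrite !mulr_sumr -big_split; apply: ler_sum => i _ /=.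
set a := `|_|; set b := `|_|; rewrite -subr_ge0.
have -> : s * a ^+ 2 + s^-1 * b ^+ 2 - 2 * (a * b) = s^-1 * (s * a - b) ^+ 2.
  by field; rewrite gt_eqF.
apply: mulr_ge0; first by rewrite invr_ge0 ltW.
apply: real_exprn_even_ge0 => //.
by apply: realB; [apply: realM; [exact: gtr0_real | exact: normr_real] | exact: normr_real].
Qed.

(** [P] diagonalises [Z^t* *m Z], and [A = Z *m P^t*] has orthogonal columns of length [s k].
    Leaving [A] unnormalised avoids a case distinction at zero singular values. *)
Lemma singular_value_decomposition n (Z : 'M[C]_n) :
  exists A P (s : 'I_n -> R), [/\ Z = A *m P, P \is unitarymx,
    A ^t* *m A = diag_mx (\row_k (s k ^+ 2)%:C), forall k, 0 <= s k
    & \sum_k s k = trnorm Z].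
Proof.
set ZZ := Z ^t* *m Z.
have hZZ : ZZ \is normalmx.
  by apply: hermitian_normalmx; apply/hermsymmxP; rewrite adjmx_mul trmxCK.
have uP := spectral_unitarymx ZZ; have ZZE := orthomx_spectralP hZZ.
set P := spectralmx ZZ in uP ZZE; set D := spectral_diag ZZ in ZZE.
have PP : P^t* *m P = 1%:M by apply: mulmx1C; apply/unitarymxP.
have AA : (Z *m P^t*)^t* *m (Z *m P^t*) = diag_mx D.
  rewrite adjmx_mul trmxCK -[LHS]mulmxA [Z^t* *m _]mulmxA -/ZZ ZZE.
  by rewrite invmx_unitary // !mulmxA (unitarymxP uP) mul1mx -mulmxA (unitarymxP uP) mulmx1.
have D_ge0 k : 0 <= D 0 k.
  have -> : D 0 k = sqnorm (col k (Z *m P^t*)).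
    have := congr1 (fun M : 'M_n => M k k) AA; rewrite [X in _ = X]mxE eqxx mulr1n /= => <-.
    by rewrite /sqnorm !mxE; apply: eq_bigr => i _; rewrite !mxE.
  exact: sqnorm_ge0.
have DE k : (complex.Re (D 0 k))%:C = D 0 k by rewrite RRe_real // ger0_real.
exists (Z *m P^t*), P, (fun k => Num.sqrt (complex.Re (D 0 k))); split.
- by rewrite -mulmxA PP mulmx1.
- exact: uP.
- rewrite AA; congr diag_mx; apply/rowP => k; rewrite !mxE sqr_sqrtr ?DE //.
  by rewrite -ler0c DE.
- by move=> k; rewrite sqrtr_ge0.
- by rewrite /trnorm.
Qed.

Lemma trnorm_ge0 n (X : 'M[C]_n) : 0 <= trnorm X.
Proof. by apply: sumr_ge0 => i _; rewrite sqrtr_ge0. Qed.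

(* It suffices to bound [L] on rank-one operators: sum over the singular value
   decomposition of [X], with [s] the singular value. *)
Lemma trnorm_functional_le n (X : 'M[C]_n) (L : 'M[C]_n -> C) (c : R) :
  (forall F : 'I_n -> 'M_n, L (\sum_k F k) = \sum_k L (F k)) ->
  (forall (z w : 'cV_n) (s : C), 0 < s ->
     2 * `|L (z *m w ^t*)| <= c%:C * (s * sqnorm w + s^-1 * sqnorm z)) ->
  `|L X| <= (c * trnorm X)%:C.
Proof.
move=> Lsum Lle; have [A [P [s [XE uP AA s_ge0 <-]]]] := singular_value_decomposition X.
pose z k := col k A; pose w k := (row k P)^t*.
have {}XE : X = \sum_k z k *m (w k)^t*.
  rewrite XE; apply/matrixP => i j; rewrite mxE summxE; apply: eq_bigr => k _.
  by rewrite trmxCK mxE big_ord1 !mxE.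
have sqz k : sqnorm (z k) = (s k ^+ 2)%:C.
  transitivity ((A^t* *m A) k k); last by rewrite AA !mxE eqxx mulr1n.
  by rewrite /sqnorm !mxE; apply: eq_bigr => i _; rewrite !mxE.
have sqw k : sqnorm (w k) = 1.
  transitivity ((P *m P^t*) k k); last by rewrite (unitarymxP uP) mxE eqxx.
  by rewrite /sqnorm trmxCK !mxE; apply: eq_bigr => i _; rewrite !mxE.
rewrite XE Lsum mulr_sumr rmorph_sum; apply: le_trans (ler_norm_sum _ _ _) _.
apply: ler_sum => k _; have := s_ge0 k; rewrite le_eqVlt => /predU1P[s0|s_gt0].
  (* For a zero singular value the column vanishes, and the hypothesis at zero vectors gives
     [L 0 = 0]. *)
  have -> : z k = 0 by apply: sqnorm_eq0; rewrite sqz -s0 expr0n.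
  have := Lle 0 0 1 ltr01; rewrite !mul0mx /sqnorm mulmx0 mxE !mulr0 addr0 mulr0.
  by rewrite -s0 mulr0 pmulr_rle0.
have s_gt0' : 0 < (s k)%:C by rewrite ltcR.
(* The weight [s k] balances the squared norms [1] and [s k ^+ 2]: both summands become [s k]. *)
have := Lle (z k) (w k) _ s_gt0'; rewrite sqw sqz.
have -> : c%:C * ((s k)%:C * 1 + (s k)%:C^-1 * (s k ^+ 2)%:C) = 2 * (c * s k)%:C.
  by rewrite [(s k ^+ 2)%:C]rmorphXn [(c * s k)%:C]rmorphM /=; field; rewrite gt_eqF.
by rewrite ler_pM2l.
Qed.

Definition contractive m n (Y : 'M[C]_(m, n)) : Prop :=
  forall v, sqnorm (Y *m v) <= sqnorm v.

(** [Y] is the adjoint of the partial isometry in the polar decomposition of [Z], so [Y *m Z] is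
    positive semidefinite with the singular values of [Z] as eigenvalues. *)
Lemma trnorm_attained n (Z : 'M[C]_n) :
  exists2 Y, contractive (Y ^t*) & \tr (Y *m Z) = (trnorm Z)%:C.
Proof.
have [A [P [s [ZE uP AA s_ge0 sE]]]] := singular_value_decomposition Z.
(* Since [0^-1 = 0], this is a pseudo-inverse: directions with zero singular value are
   annihilated. *)
pose S := diag_mx (\row_k (s k)^-1%:C) : 'M[C]_n.
have hS : S^t* = S.
  rewrite /S tr_diag_mx map_diag_mx; congr diag_mx; apply/rowP => k; rewrite !mxE.
  by apply/CrealP/complex_realP; exists (s k)^-1.
exists (P^t* *m S *m A^t*); last first.
  have -> : P^t* *m S *m A^t* *m Z = P^t* *m (S *m (A^t* *m A) *m P).
    by rewrite [in LHS]ZE !mulmxA.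
  rewrite mxtrace_mulC -(mulmxA _ P) (unitarymxP uP) mulmx1 AA mulmx_diag -sE.
  rewrite mxtrace_diag rmorph_sum; apply: eq_bigr => k _; rewrite !mxE -rmorphM /=.
  have [->|sk0] := eqVneq (s k) 0; first by rewrite expr0n mulr0.
  by rewrite expr2 mulKf.
move=> v; rewrite !adjmx_mul !trmxCK hS -(sqnorm_unitary v uP).
have -> : A *m (S *m P) *m v = (A *m S) *m (P *m v) by rewrite !mulmxA.
move: (P *m v) => u; rewrite sqnorm_mul adjmx_mul hS.
have -> : S *m A^t* *m (A *m S) = S *m (A^t* *m A) *m S by rewrite !mulmxA.
rewrite AA !mulmx_diag mul_mx_diag mxE sqnormE.
apply: ler_sum => k _; rewrite !mxE -!rmorphM /= mulrAC -normCKC.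
have [->|sk0] := eqVneq (s k) 0; first by rewrite invr0 !mul0r mulr0 exprn_ge0.
by rewrite expr2 mulKf // mulfV // mulr1.
Qed.

(** The other half of the duality in [trnorm_attained]. On a rank-one operator the trace is an inner
    product, which Young's inequality bounds. *)
Lemma trnorm_ge n (Y Z : 'M[C]_n) : contractive (Y ^t*) -> `|\tr (Y *m Z)| <= (trnorm Z)%:C.
Proof.
move=> cY; rewrite -[trnorm Z]mul1r.
apply: (@trnorm_functional_le _ _ (fun X => \tr (Y *m X))) => [F|z w s s0].
  by rewrite mulmx_sumr linear_sum.
rewrite mulmxA mxtrace_mulC trace_mx11 mulmxA -[Y]trmxCK -adjmx_mul mul1r.
apply: le_trans (young_dot _ _ s0) _.
by rewrite lerD2r ler_wpM2l // ltW.
Qed.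

(** A dual witness [Y] turns the trace norm of the image into the value at [X] of a linear
    functional. On [z *m w^t*] each Kraus term is an inner product of [Y^t* *m (K a *m w)] and
    [K a *m z]; Young's inequality with one common weight lets the hypothesis act on [w] and [z]
    separately. *)
Lemma trnorm_kraus_le (I : finType) m n (c : I -> C) (K : I -> 'M[C]_(n, m)) (b : R) X :
  (forall u, \sum_a `|c a| * sqnorm (K a *m u) <= b%:C * sqnorm u) ->
  trnorm (\sum_a c a *: (K a *m X *m (K a)^t*)) <= b * trnorm X.
Proof.
move=> Kle; have [Y cY trY] := trnorm_attained (\sum_a c a *: (K a *m X *m (K a)^t*)).
rewrite -lecR -trY; apply: le_trans (real_ler_norm _) _.
  by rewrite trY; apply/complex_realP; eexists.
apply: (@trnorm_functional_le _ _
  (fun X => \tr (Y *m \sum_a c a *: (K a *m X *m (K a)^t*)))) => [F|z w s s0].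
  rewrite -linear_sum -mulmx_sumr exchange_big; congr (\tr (_ *m _)).
  by apply: eq_bigr => a _; rewrite -scaler_sumr mulmx_sumr mulmx_suml.
apply: (@le_trans _ _ (\sum_a `|c a| * (s * sqnorm (K a *m w) + s^-1 * sqnorm (K a *m z)))).
  rewrite mulmx_sumr linear_sum; apply: le_trans (ler_wpM2l _ (ler_norm_sum _ _ _)) _ => //.
  rewrite mulr_sumr; apply: ler_sum => a _; rewrite /= -scalemxAr mxtraceZ normrM mulrCA.
  apply: ler_wpM2l => //.
  have -> : \tr (Y *m (K a *m (z *m w^t*) *m (K a)^t*))
          = ((Y^t* *m (K a *m w))^t* *m (K a *m z)) 0 0.
    rewrite -trace_mx11 !adjmx_mul trmxCK.
    have -> : K a *m (z *m w^t*) *m (K a)^t* = K a *m z *m (w^t* *m (K a)^t*).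
      by rewrite !mulmxA.
    by rewrite [in LHS]mulmxA [LHS]mxtrace_mulC (mulmxA (w^t* *m _)).
  apply: le_trans (young_dot _ _ s0) _.
  by rewrite lerD2r ler_wpM2l // ltW.
under eq_bigr do rewrite mulrDr ![`|_| * (_ * _)]mulrCA.
rewrite big_split -!mulr_sumr mulrDr ![b%:C * (_ * _)]mulrCA.
by apply: lerD; apply: ler_wpM2l; rewrite ?invr_ge0 ?(ltW s0).
Qed.

End TraceNorm.

(** * The upper bound *)

Section UpperBound.
Variable R : realType.
Local Notation C := R[i].
Local Open Scope complex_scope.

(** The term [e *: (L^t* *m L)] is a positive slack: it expresses an operator inequality with bound
    [b] as an equation, which tensors directly with the identity on the reference. *)
Lemma dnorm_kraus_le (I : finType) m n p (f : superop R m n) (c : I -> C)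
    (K : I -> 'M[C]_(n, m)) (L : 'M[C]_(p, m)) (b : R) (e : C) :
  0 <= b -> 0 <= e ->
  (forall X, f X = \sum_a c a *: (K a *m X *m (K a) ^t*)) ->
  \sum_a `|c a| *: ((K a)^t* *m K a) + e *: (L^t* *m L) = b%:C%:M ->
  (dnorm f <= b%:E)%E.
Proof.
move=> b0 e0 fE KL; apply: ge_ereal_sup => _ [r [X [X1 ->]]].
rewrite lee_fin (@ampliation_kraus _ I _ _ _ _ c K) //.
apply: le_trans (_ : b * trnorm X <= b); last by rewrite -[leRHS]mulr1 ler_wpM2l.
apply: trnorm_kraus_le => u.
rewrite -subr_ge0; suff -> : b%:C * sqnorm u - \sum_a `|c a| * sqnorm (1%:M *t K a *m u)
    = e * sqnorm ((1%:M : 'M_r) *t L *m u) by rewrite mulr_ge0 ?sqnorm_ge0.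
apply/eqP; rewrite subr_eq addrC; apply/eqP.
have sqnormb : b%:C * sqnorm u = (u^t* *m ((1%:M : 'M_r) *t b%:C%:M) *m u) 0 0.
  rewrite -(scalemx1 _ b%:C) tensmxZr tens_scalar_mx1 scalemx1 mul_mx_scalar.
  by rewrite -scalemxAl mxE.
rewrite sqnormb -KL.
rewrite tensmxDr mulmxDr mulmxDl [LHS]mxE; congr (_ + _).
  rewrite tensmx_sumr mulmx_sumr mulmx_suml summxE; apply: eq_bigr => a _.
  rewrite tensmxZr -scalemxAr -scalemxAl mxE sqnorm_mul adjmx_tens tensmx_mul.
  by rewrite trmx1 map_mx1 mulmx1.
rewrite tensmxZr -scalemxAr -scalemxAl mxE sqnorm_mul adjmx_tens tensmx_mul.
by rewrite trmx1 map_mx1 mulmx1.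
Qed.

(** Up to normalisation, matrix units are Kraus operators of the completely depolarizing map. *)
Lemma sum_delta_conj m n (Y : 'M[C]_m) :
  \sum_(p : 'I_m * 'I_n) delta_mx p.2 p.1 *m Y *m delta_mx p.1 p.2 = (\tr Y)%:M.
Proof.
rewrite -(pair_big xpredT xpredT (fun i j => delta_mx j i *m Y *m delta_mx i j)) /=.
rewrite -scalemx1 /mxtrace scaler_suml; apply: eq_bigr => i _.
apply/matrixP => k l; rewrite summxE (bigD1 k) //= big1 ?addr0 => [|j jk].
  by rewrite mulmx_deltaE delta_mulmxE !mxE eqxx mul1r eq_sym.
by rewrite mulmx_deltaE delta_mulmxE eq_sym (negPf jk) !mul0r.
Qed.

Lemma sum_delta_diag n : \sum_i delta_mx i i = 1%:M :> 'M[C]_n.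
Proof.
rewrite [RHS]matrix_sum_delta; apply: eq_bigr => i _.
rewrite (bigD1 i) //= big1 => [|j ji]; rewrite mxE ?eqxx ?scale1r ?addr0 //.
by rewrite eq_sym (negPf ji) scale0r.
Qed.

Variable d : nat.
Hypothesis d_gt1 : (1 < d)%N.
Local Notation T := (bellmx R d).
Let x : R := d%:R.
Let t : C := d%:R.

Let x_ge2 : 2 <= x. Proof. by rewrite /x ler_nat. Qed.
Let x_gt0 : 0 < x. Proof. by apply: lt_le_trans x_ge2. Qed.
Let t_neq0 : t != 0. Proof. exact: dim_neq0. Qed.
Let xC : x%:C = t. Proof. by rewrite /x rmorph_nat. Qed.

(** Traceless part of a matrix unit. The map with these Kraus operators has as Choi operator the
    projector onto the complement of the maximally entangled vector. *)
Definition depol_kraus (a b : 'I_d) : 'M[C]_d :=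
  delta_mx b a - ((a == b)%:R / t) *: 1%:M.

Lemma depol_kraus_adj a b : (depol_kraus a b)^t* = depol_kraus b a.
Proof.
rewrite /depol_kraus raddfB /= map_mxB adjmx_delta adjmxZ trmx1 map_mx1.
by rewrite rmorphM fmorphV /= !conjC_nat eq_sym.
Qed.

Lemma depol_kraus_sum (Y : 'M[C]_d) :
  \sum_(p : 'I_d * 'I_d) depol_kraus p.1 p.2 *m Y *m depol_kraus p.2 p.1
  = (\tr Y)%:M - t^-1 *: Y.
Proof.
have diag_sum (G : 'I_d -> 'I_d -> 'M[C]_d) :
    \sum_(p : 'I_d * 'I_d) (p.1 == p.2)%:R *: G p.1 p.2 = \sum_i G i i.
  rewrite -(pair_big xpredT xpredT (fun i j => (i == j)%:R *: G i j)) /=.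
  apply: eq_bigr => i _; rewrite (bigD1 i) //= big1 ?eqxx ?scale1r ?addr0 // => j ji.
  by rewrite eq_sym (negPf ji) scale0r.
(* Corrections occur only for equal indices and sum to [d * t^-2 - 2 * t^-1 = - t^-1] times [Y]. *)
transitivity (\sum_(p : 'I_d * 'I_d) (delta_mx p.2 p.1 *m Y *m delta_mx p.1 p.2
   + (p.1 == p.2)%:R *: (t^-2 *: Y - t^-1 *: (delta_mx p.1 p.1 *m Y)
       - t^-1 *: (Y *m delta_mx p.1 p.1)))).
  apply: eq_bigr => -[a b] _ /=; rewrite /depol_kraus [b == a]eq_sym.
  rewrite !(mulmxBl, mulmxBr) -!(scalemxAl, scalemxAr) !(mul1mx, mulmx1).
  have [->|] := eqVneq a b; last first.
    by rewrite !mul0r !scale0r !subr0 addr0.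
  rewrite !mul1r !scale1r !scalerA.
  set A := _ *m Y *m _; set B := _ *m Y; set D := Y *m _; clearbody A B D.
  by apply/matrixP => i j; rewrite !mxE; field.
rewrite big_split sum_delta_conj; congr (_ + _).
rewrite (diag_sum (fun a b => t^-2 *: Y - t^-1 *: (delta_mx a a *m Y)
       - t^-1 *: (Y *m delta_mx a a))).
rewrite !sumrB sumr_const card_ord -!scaler_sumr -mulmx_suml -mulmx_sumr sum_delta_diag.
rewrite mul1mx mulmx1 -scaler_nat scalerA.
by apply/matrixP => i j; rewrite !mxE; field.
Qed.

(* Signed Kraus decomposition of [Pstar]: the first family is supported on the
   complement [Q] of the maximally entangled vector of [S (x) P1], the other two
   on that vector, where [Pstar] has Choi operator [d Omega - (1 - d^-2)]; the
   weights add up to [Q + b (1 - Q) <= b]. *)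
Lemma dnorm_Pstar_le :
  (dnorm (Pstar R d) <= (2 * x ^+ 2 - 3 + 2 / x ^+ 2)%:E)%E.
Proof.
pose Q : 'M[C]_(d * (d * d)) := 1%:M - t^-1 *: (T^t* *m T).
have hQ : Q^t* = Q.
  rewrite /Q raddfB /= map_mxB adjmxZ adjmx_mul trmxCK trmx1 map_mx1.
  by rewrite fmorphV /= conjC_nat.
have PP : T^t* *m T *m (T^t* *m T) = t *: (T^t* *m T).
  rewrite -mulmxA [T *m (T^t* *m T)]mulmxA bellmxK mul_scalar_mx.
  by rewrite -scalemxAr.
have QQ : Q *m Q = Q.
  rewrite /Q mulmxBl mul1mx -scalemxAl mulmxBr mulmx1 -scalemxAr PP scalerA.
  by rewrite (mulVf t_neq0) scale1r subrr scaler0 subr0.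
(* Since [\tr (Q *m X) = \tr X - \tr M / d] with [M = Mop X], removing the [c1] term from [Pstar]
   leaves [d M - (1 - d^-2) \tr M]. Splitting off [- c3] times the map [\tr M - M / d] leaves
   [c2 = d - c3 / d] times [M]. *)
pose c1 : R := x^-1; pose c2 : R := x - x^-1 + x^-3; pose c3 : R := 1 - x^-2.
pose I := (('I_(d * (d * d)) * 'I_d) + (unit + 'I_d * 'I_d))%type.
pose c (a : I) : C := match a with
  | inl _ => c1%:C | inr (inl _) => c2%:C | inr (inr _) => - c3%:C end.
pose K (a : I) : 'M[C]_(d, d * (d * d)) := match a with
  | inl p => delta_mx p.2 p.1 *m Q
  | inr (inl _) => T
  | inr (inr p) => depol_kraus p.1 p.2 *m T end.
have x_ge1 : 1 <= x by apply: le_trans x_ge2; rewrite ler1n.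
have x1 : x^-1 <= 1 by rewrite invf_le1.
have x1_ge0 : 0 <= x^-1 by rewrite invr_ge0 ltW.
have c2_ge0 : 0 <= c2.
  rewrite /c2; have : 0 <= x^-3 by rewrite invr_ge0 exprn_ge0 // ltW.
  have := x_ge1; lra.
have c3_ge0 : 0 <= c3.
  by rewrite /c3 subr_ge0 invf_le1 ?exprn_gt0 // exprn_ege1.
have c1C : c1%:C = t^-1 by rewrite fmorphV /= xC.
have c2C : c2%:C = t - t^-1 + t^-3.
  by rewrite rmorphD rmorphB /= !fmorphV rmorphXn /= xC.
have c3C : c3%:C = 1 - t^-2 by rewrite rmorphB fmorphV rmorphXn rmorph1 /= xC.
have x2C (n : nat) : (2 * x ^+ 2 - n%:R + 2 / x ^+ 2)%:C = 2 * t ^+ 2 - n%:R + 2 / t ^+ 2.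
  by rewrite rmorphD rmorphB !rmorphM fmorphV !rmorph_nat !rmorphXn /= xC.
have x2_ge (n : nat) : (n < 8)%N -> 0 <= 2 * x ^+ 2 - n%:R + 2 / x ^+ 2.
  move=> n8; have : n%:R <= 8%:R :> R by rewrite ler_nat ltnW.
  have : 0 <= 2 / x ^+ 2 by rewrite divr_ge0 // exprn_ge0 // ltW.
  have : 4%:R <= x ^+ 2 by rewrite -natrX ler_nat (@leq_exp2r 2 d 2).
  lra.
(* On the entangled part the weights give [c2 + c3 * (t - t^-1) = b / t] times [T^t* *m T], that is
   [b] times [1 - Q], where [b] is the claimed bound. The first family gives [Q], so the slack is
   [b - 1] times [Q]. *)
apply: (@dnorm_kraus_le I _ _ _ _ c K Q _ (2 * x ^+ 2 - 4%:R + 2 / x ^+ 2)%:C).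
- exact: (x2_ge 3).
- by rewrite ler0c x2_ge.
- move=> X; rewrite !big_sumType /= sum_unit.
  have -> : \sum_(p : 'I_(d * (d * d)) * 'I_d) c1%:C *:
      (delta_mx p.2 p.1 *m Q *m X *m (delta_mx p.2 p.1 *m Q)^t*)
      = (t^-1 * \tr (Q *m X)) *: 1%:M.
    rewrite -scaler_sumr c1C -scalerA; congr (_ *: _).
    rewrite scalemx1 -[in RHS]QQ -[in RHS]mulmxA [in RHS]mxtrace_mulC -sum_delta_conj.
    by apply: eq_bigr => p _; rewrite adjmx_mul hQ adjmx_delta !mulmxA.
  have -> : \sum_p (- c3%:C) *: (depol_kraus p.1 p.2 *m T *m X *m
        (depol_kraus p.1 p.2 *m T)^t*)
      = (- c3%:C) *: ((\tr (Mop X))%:M - t^-1 *: Mop X).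
    rewrite -scaler_sumr -depol_kraus_sum; congr (_ *: _); apply: eq_bigr => p _.
    by rewrite adjmx_mul depol_kraus_adj MopE !mulmxA.
  have -> : \tr (Q *m X) = \tr X - t^-1 * \tr (Mop X).
    rewrite /Q mulmxBl mul1mx -scalemxAl raddfB /= mxtraceZ MopE -[T^t* *m T *m X]mulmxA.
    by rewrite [in LHS]mxtrace_mulC.
  rewrite -MopE -(scalemx1 _ (\tr (Mop X))) c2C c3C /Pstar -/t; move: (Mop X) => M.
  move: (1%:M) (\tr X) (\tr M) => E a b.
  by apply/matrixP => i j; rewrite !mxE; field.
rewrite !big_sumType /= sum_unit.
have -> : `|- c3%:C| = c3%:C by rewrite normrN ger0_norm ?ler0c.
have -> : `|c2%:C| = c2%:C by rewrite ger0_norm ?ler0c.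
have -> : `|c1%:C| = c1%:C by rewrite ger0_norm ?ler0c.
have -> : \sum_(p : 'I_(d * (d * d)) * 'I_d) c1%:C *:
    ((delta_mx p.2 p.1 *m Q)^t* *m (delta_mx p.2 p.1 *m Q)) = Q.
  rewrite -scaler_sumr c1C; transitivity (t^-1 *: (t *: Q)).
    congr (_ *: _).
    transitivity (\sum_(p : 'I_(d * (d * d)) * 'I_d) Q *m delta_mx p.1 p.1 *m Q).
      apply: eq_bigr => p _; rewrite adjmx_mul hQ adjmx_delta.
      by rewrite -(mul_delta_mx p.2 p.1 p.1) -!mulmxA.
    rewrite -(pair_bigA _ (fun i j => Q *m delta_mx i i *m Q)) /=.
    under eq_bigr do rewrite sumr_const card_ord.
    by rewrite sumrMnl -mulmx_suml -mulmx_sumr sum_delta_diag mulmx1 QQ scaler_nat.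
  by rewrite scalerA (mulVf t_neq0) scale1r.
(* After exchanging the indices this is [depol_kraus_sum] at the identity. *)
have ksum : \sum_(p : 'I_d * 'I_d) depol_kraus p.2 p.1 *m depol_kraus p.1 p.2
    = (t - t^-1)%:M.
  rewrite -(pair_bigA _ (fun i j => depol_kraus j i *m depol_kraus i j)) exchange_big.
  rewrite pair_bigA /=; transitivity ((\tr (1%:M : 'M[C]_d))%:M - t^-1 *: 1%:M : 'M[C]_d).
    by rewrite -depol_kraus_sum; apply: eq_bigr => p _; rewrite mulmx1.
  by rewrite mxtrace1 scalemx1 raddfB.
have -> : \sum_p c3%:C *: ((depol_kraus p.1 p.2 *m T)^t* *m (depol_kraus p.1 p.2 *m T))
  = (c3%:C * (t - t^-1)) *: (T^t* *m T).
  rewrite -scaler_sumr -scalerA; congr (_ *: _).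
  rewrite [RHS]scalemxAl -mul_mx_scalar -ksum mulmx_sumr mulmx_suml.
  by apply: eq_bigr => p _; rewrite adjmx_mul depol_kraus_adj !mulmxA.
rewrite hQ QQ (x2C 4) (x2C 3) c2C c3C /Q; move: (T^t* *m T) => P.
by apply/matrixP => i j; rewrite !mxE; field.
Qed.

End UpperBound.

(** * The lower bound *)

Section LowerBound.
Variables (R : realType) (d : nat).
Local Notation C := R[i].
Local Open Scope complex_scope.
Hypothesis d_gt1 : (1 < d)%N.
Let x : R := d%:R.
Let t : C := d%:R.
Let t_neq0 : t != 0. Proof. exact: dim_neq0. Qed.

Let mulrnE (y : C) : y *+ d = t * y. Proof. by rewrite mulr_natl. Qed.

(** With a dual witness [Y], the trace norm is the inner product of [Y^t* *m v] and [v]; Young's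
    inequality with weight one and contractivity bound it by [sqnorm v]. *)
Lemma trnorm_pure_le n (v : 'cV[C]_n) : sqnorm v <= 1 -> trnorm (v *m v^t*) <= 1.
Proof.
move=> v1; have [Y cY trY] := trnorm_attained (v *m v^t*).
rewrite -lecR; apply: le_trans v1; rewrite -(ler_pM2l (ltr0Sn C 1)).
have := young_dot (Y^t* *m v) v (@ltr01 C); rewrite invr1 !mul1r => Yv.
have -> : (trnorm (v *m v^t*))%:C = `|((Y^t* *m v)^t* *m v) 0 0|.
  rewrite -trace_mx11 adjmx_mul trmxCK -mulmxA mxtrace_mulC -mulmxA trY.
  by rewrite ger0_norm // ler0c trnorm_ge0.
apply: le_trans Yv _; rewrite mulr_natl mulr2n lerD2r; exact: cY.
Qed.

(* On [R (x) S (x) P1 (x) P2]: [S] is maximally entangled with [P1], and [P2]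
   with the reference [R]. *)
Definition optimal_input : 'cV[C]_(d * (d * (d * d))) :=
  t^-1 *: \sum_i \sum_k
    delta_mx (mxtens_index (i, mxtens_index (k, mxtens_index (k, i)))) 0.

Lemma optimal_inputE : optimal_input *m optimal_input^t* =
  t^-2 *: \sum_i \sum_j delta_mx i j *t
    (\sum_k \sum_l delta_mx k l *t (delta_mx k l *t delta_mx i j)).
Proof.
rewrite /optimal_input; set w := \sum_i _; rewrite adjmxZ -scalemxAl -scalemxAr scalerA.
rewrite fmorphV /= conjC_nat -invfM -expr2; congr (_ *: _).
have -> : w^t* = \sum_j \sum_l
    delta_mx 0 (mxtens_index (j, mxtens_index (l, mxtens_index (l, j)))).
  rewrite raddf_sum map_mx_sum; apply: eq_bigr => i _.
  rewrite raddf_sum map_mx_sum; apply: eq_bigr => k _; exact: adjmx_delta.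
rewrite mulmx_suml; apply: eq_bigr => i _; rewrite mulmx_sumr; apply: eq_bigr => j _.
rewrite tensmx_sumr mulmx_suml; apply: eq_bigr => k _.
rewrite tensmx_sumr mulmx_sumr; apply: eq_bigr => l _.
by rewrite mul_delta_mx !tens_delta_mx.
Qed.

Lemma optimal_input_unit : sqnorm optimal_input = 1.
Proof.
rewrite /sqnorm -trace_mx11 mxtrace_mulC optimal_inputE mxtraceZ linear_sum /=.
transitivity (t^-2 * \sum_(i < d) t).
  congr (_ * _); apply: eq_bigr => i _; rewrite linear_sum /=.
  under eq_bigr => j _ do rewrite mxtrace_tens mxtrace_delta.
  rewrite sum_delta_mul linear_sum /=; transitivity (\sum_(k < d) (1 : C)); last first.
    by rewrite sumr_const card_ord.
  apply: eq_bigr => k _; rewrite linear_sum /=.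
  under eq_bigr => l _ do rewrite !mxtrace_tens !mxtrace_delta.
  by rewrite sum_delta_mul !eqxx mulr1.
by rewrite sumr_const card_ord -mulr_natl -/t -expr2 mulVf // expf_neq0.
Qed.

(** Here [Mop] returns [delta_mx i j], whose multiple by [d] contributes [d] for each of the [d^2]
    pairs; the identity term contributes only for [i = j]. *)
Lemma Pstar_swap_trace (k l : 'I_d) :
  \sum_i \sum_j \tr (delta_mx j i *m
    Pstar R d (delta_mx k l *t (delta_mx k l *t delta_mx i j)))
  = (k == l)%:R - t + t ^+ 3.
Proof.
transitivity (\sum_(i < d) \sum_(j < d)
    ((i == j)%:R * ((k == l)%:R * ((k == l)%:R * (i == j)%:R) / t - (i == j)%:R) + t)).
  apply: eq_bigr => i _; apply: eq_bigr => j _.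
  rewrite /Pstar Mop_tens sum_delta_mx_mul mxE !eqxx scale1r !mxtrace_tens !mxtrace_delta.
  rewrite mulmxDr -!scalemxAr mulmx1 mul_delta_mx mxtraceD !mxtraceZ !mxtrace_delta eqxx.
  by rewrite mulr1 -/t mulrC [j == i]eq_sym.
under eq_bigr => i _ do rewrite big_split /= sum_delta_mul eqxx sumr_const card_ord.
by rewrite sumr_const card_ord !mulrnE; case: eqP => _ /=; field.
Qed.

Variable P : superop R (d * (d * d)) d.
Hypothesis exP : exact_retriever (cptp R d) P.

Lemma dnorm_exact_ge : ((2 * x ^+ 2 - 3 + 2 / x ^+ 2)%:E <= dnorm P)%E.
Proof.
pose X := optimal_input *m optimal_input^t*.
apply: (@le_trans _ _ (trnorm (ampliation P X))%:E); last first.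
  apply: ereal_sup_ubound; exists d, X; split=> //.
  by apply: trnorm_pure_le; rewrite optimal_input_unit.
rewrite lee_fin -lecR.
have ampX : ampliation P X = t^-2 *: \sum_i \sum_j delta_mx i j *t
    (\sum_k \sum_l P (delta_mx k l *t (delta_mx k l *t delta_mx i j))).
  rewrite /X optimal_inputE linearZ linear_sum; congr (_ *: _); apply: eq_bigr => i _.
  rewrite linear_sum; apply: eq_bigr => j _ /=; rewrite ampliation_tens linear_sum.
  by congr (_ *t _); apply: eq_bigr => k _; rewrite linear_sum.
pose Om := Omega R d.
(* The unnormalised maximally entangled vector, of squared norm [d]; the projector is
   [t^-1 *: Om]. *)
pose w : 'cV[C]_(d * d) := \sum_i delta_mx (mxtens_index (i, i)) 0.
have OmE : Om = w *m w^t*.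
  rewrite mulmx_suml; apply: eq_bigr => i _; rewrite raddf_sum map_mx_sum mulmx_sumr.
  by apply: eq_bigr => j _; rewrite adjmx_delta mul_delta_mx tens_delta_mx.
have trOm1 : \tr Om = t.
  rewrite linear_sum /=; transitivity (\sum_(k < d) (1 : C)); last first.
    by rewrite sumr_const card_ord.
  apply: eq_bigr => i _; rewrite linear_sum /=.
  under eq_bigr => j _ do rewrite mxtrace_tens !mxtrace_delta.
  by rewrite sum_delta_mul eqxx.
have hOm : Om^t* = Om by rewrite OmE adjmx_mul trmxCK.
have OmOm : Om *m Om = t *: Om.
  have ww : w^t* *m w = t%:M by rewrite [LHS]mx11_scalar -trace_mx11 mxtrace_mulC -OmE trOm1.
  by rewrite OmE -mulmxA (mulmxA (w^t*)) ww mul_scalar_mx -scalemxAr.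
(* A Hermitian unitary, hence an admissible dual witness for the trace norm. *)
pose Y := (2 / t) *: Om - 1%:M.
have hY : Y^t* = Y.
  rewrite /Y raddfB /= map_mxB adjmxZ hOm trmx1 map_mx1.
  by rewrite rmorphM fmorphV /= !conjC_nat.
have YY : Y *m Y = 1%:M.
  rewrite /Y mulmxBl mul1mx -scalemxAl mulmxBr mulmx1 -scalemxAr OmOm !scalerA.
  by apply/matrixP => i j; rewrite !mxE; field.
have cY : contractive (Y^t*).
  by move=> v; rewrite sqnorm_mul hY hY YY mulmx1.
have trX : \tr (ampliation P X) = 1.
  case: exP => -[_ tpP] _; rewrite mxtrace_ampliation // mxtrace_mulC trace_mx11.
  exact: optimal_input_unit.
have trOm : \tr (Omega R d *m ampliation P X) = t^-1 - t + t ^+ 3.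
  rewrite ampX -scalemxAr mxtraceZ.
  (* Pairing with [Omega] selects entry [(i, j)] of block [(i, j)]. Moving [k] and [l] outermost
     exposes the sums that are the same for all exact retrievers. *)
  transitivity (t^-2 * \sum_k \sum_l \sum_i \sum_j
      \tr (delta_mx j i *m P (delta_mx k l *t (delta_mx k l *t delta_mx i j)))).
    congr (_ * _); rewrite mulmx_sumr linear_sum /=.
    transitivity (\sum_i \sum_k \sum_l \sum_j
      \tr (delta_mx j i *m P (delta_mx k l *t (delta_mx k l *t delta_mx i j)))).
      apply: eq_bigr => i _; rewrite mulmx_sumr linear_sum /=.
      under [RHS]eq_bigr => k _ do rewrite exchange_big.
      rewrite [RHS]exchange_big; apply: eq_bigr => j _.
      rewrite mxtrace_Omega_tens sum_delta_mx_mul summxE; apply: eq_bigr => k _.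
      by rewrite summxE; apply: eq_bigr => l _; rewrite mxtrace_mul_delta.
    by rewrite exchange_big; apply: eq_bigr => k _; exact: exchange_big.
  transitivity (t^-2 * \sum_(k < d) \sum_(l < d) ((k == l)%:R * 1 + (t ^+ 3 - t))).
    congr (_ * _); apply: eq_bigr => k _; apply: eq_bigr => l _.
    rewrite (exact_retriever_swap_trace d_gt1 _ _ exP (exact_retriever_Pstar R d_gt1)).
    by rewrite Pstar_swap_trace mulr1 addrAC -addrA.
  under eq_bigr => k _ do rewrite big_split /= sum_delta_mul sumr_const card_ord.
  by rewrite sumr_const card_ord !mulrnE; field.
apply: le_trans (trnorm_ge _ cY).
rewrite /Y mulmxBl mul1mx -scalemxAl raddfB /= mxtraceZ trX trOm.
have -> : 2 / t * (t^-1 - t + t ^+ 3) - 1 = (2 * x ^+ 2 - 3 + 2 / x ^+ 2)%:C.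
  rewrite rmorphD rmorphB !rmorphM fmorphV !rmorph_nat !rmorphXn /= rmorph_nat -/t.
  by field.
by apply: real_ler_norm; apply/complex_realP; eexists.
Qed.

End LowerBound.

(** * Uniqueness, optimality and the value of the overhead *)

Theorem theorem1 (R : realType) (d : nat) (hd : (2 <= d)%N) :
  [/\ covariant (Pstar R d),
      exact_retriever (cptp R d) (Pstar R d),
      forall P : superop R (d * (d * d)) d,
        covariant P -> exact_retriever (cptp R d) P -> P =1 Pstar R d
    & forall (rho : 'M[R[i]]_d) (f : superop R d d),
        density rho -> cptp R d f ->
        Pstar R d (rho *t choi_state f) = f rho] /\
  [/\ forall P : superop R (d * (d * d)) d,
        exact_retriever (cptp R d) P -> (dnorm (Pstar R d) <= dnorm P)%E,
      overhead1 (cptp R d) = dnorm (Pstar R d)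
    & dnorm (Pstar R d) = (2 * d%:R ^+ 2 - 3 + 2 / d%:R ^+ 2)%:E].
Proof.
have exPs := exact_retriever_Pstar R hd.
have le_Ps P : exact_retriever (cptp R d) P -> (dnorm (Pstar R d) <= dnorm P)%E.
  by move=> exP; apply: le_trans (dnorm_Pstar_le R hd) (dnorm_exact_ge hd exP).
split; split.
- exact: covariant_Pstar.
- exact: exPs.
- move=> P covP exP X.
  exact: (covariant_retriever_unique hd covP (@covariant_Pstar R d) exP exPs X).
- by move=> rho f [_ tr1] [_ tpf]; apply: Pstar_exact.
- exact: le_Ps.
- apply/le_anti/andP; split; first by apply: ereal_inf_lbound; exists (Pstar R d).
  by apply: le_ereal_inf_tmp => _ [P exP <-]; apply: le_Ps.
- by apply/le_anti/andP; split; [exact: dnorm_Pstar_le | exact: dnorm_exact_ge].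
Qed.
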